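(* Let $h>0$ and $\beta>0$, and let $(\pi_k)_{k\ge0}$ be the equilibrium distribution of the $Q$-process. The equilibrium queue size $N$ has expectation $$E(N)=\pi_0\frac{(H(u(\beta))-h-\mu_1)(-\beta)-(H(u(\beta))-h)(B_c'(1)-\beta)}{\beta^2}+\frac{\sum_{k=1}^{c-1}\pi_k(c-k)b_0[\beta+u(\beta)^{k-1}(1-u(\beta))B_c'(1)]}{\beta^2},$$ and the equilibrium waiting queue size $L_w$ has expectation $$E(L_w)=\pi_0\Big[\frac{(H(u(\beta))-h-\mu_1)(-\beta)-(H(u(\beta))-h)(B_c'(1)-\beta)}{\beta^2}+c\Big]+\frac{\sum_{k=1}^{c-1}\pi_k(c-k)[b_0(\beta+u(\beta)^{k-1}(1-u(\beta))B_c'(1))+\beta^2]}{\beta^2}-c.$$ Here $\pi_0=\beta\big[\beta+H(1)-H(u(\beta))+\sum_{k=1}^{c-1}L_k(\beta)u(\beta)^{k-1}(c-k)b_0(1-u(\beta))\big]^{-1}$ and $\pi_k=\pi_0L_k(\beta)$ for $1\le k\le c-1$.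
   Context: Let $\mathbf E=\{0,1,2,\dots\}$ and let $c\ge 1$ be an integer (the number of servers). Let $(b_j)_{j\ge0}$ be reals with $b_j\ge 0$ for $j\ne 1$, $0<-b_1=\sum_{j\ne1}b_j<\infty$, $b_0>0$ and $\sum_{j\ge2}b_j>0$. Let $\beta>0$ and $h_j\ge0$ ($j\ge1$) with $0<h:=\sum_{j\ge1}h_j<\infty$. The $Q$-process is the continuous-time Markov chain on $\mathbf E$ with conservative bounded $q$-matrix $Q=Q^*+Q_s+Q_d$, where: $Q^*$ has entries $q^*_{i,i-1}=\min(i,c)b_0$, $q^*_{ii}=b_1-[\min(i,c)-1]b_0$, $q^*_{ij}=b_{j-i+1}$ ($j\ge i+1$) for $i\ge1$, and $0$ otherwise; $Q_s$ has entries $q^{(s)}_{00}=-h$, $q^{(s)}_{0j}=h_j$ ($j\ge1$), and $0$ otherwise; $Q_d$ has entries $q^{(d)}_{i0}=\beta$, $q^{(d)}_{ii}=-\beta$ for $i\ge1$, and $0$ otherwise. This process is positive recurrent; $N$ is a random variable with its equilibrium distribution and $L_w=\max(N-c,0)$ is the number of waiting customers. Let $(p^*_{ij}(t))$ be the transition function of the chain with $q$-matrix $Q^*$, $\phi^*_{ij}(\lambda)=\int_0^\infty e^{-\lambda t}p^*_{ij}(t)\,dt$ ($\lambda>0$), and $L_j(\lambda)=\sum_{i\ge1}h_i\phi^*_{ij}(\lambda)$. Define $B(s)=\sum_{j\ge0}b_js^j$, $B_c(s)=B(s)+(c-1)b_0(1-s)$, $U_\lambda(s)=B_c(s)-\lambda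 s$, $H(s)=\sum_{j\ge1}h_js^j$, $\mu_1=H'(1)=\sum_{j\ge1}jh_j$. For each $\lambda>0$, $u(\lambda)\in(0,1)$ is the unique root of $U_\lambda(s)=0$ on $[0,1]$. Derivatives at $1$ are left derivatives; $\mu_1$ and $B_c'(1)$ may equal $+\infty$, in which case the right-hand sides are read as $+\infty$. Empty sums are $0$. *)

(* Defs.v *)
From HB Require Import structures.
From mathcomp Require Import all_boot all_order all_algebra.
From mathcomp Require Import all_classical all_reals all_analysis.

Set Implicit Arguments.
Unset Strict Implicit.
Unset Printing Implicit Defensive.

Import Order.TTheory GRing.Theory Num.Theory.
Import numFieldNormedType.Exports.

Local Open Scope classical_set_scope.
Local Open Scope ring_scope.

(** * Transition functions on the state space [nat] *)

(* [p i j t] stands for p_ij(t); only times [0 <= t] matter.  Row sums are only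
   required to be at most 1: a bounded conservative q-matrix has exactly one
   transition function in this sense, and its row sums are all equal to 1. *)
Record transition_function (R : realType) (p : nat -> nat -> R -> R) : Prop :=
  TransitionFunction {
    tf_ge0 : forall i j t, 0 <= t -> 0 <= p i j t ;
    tf_le1 : forall i t, 0 <= t -> (\sum_(0 <= j <oo) (p i j t)%:E <= 1)%E ;
    tf_id : forall i j, p i j 0 = (i == j)%:R ;
    tf_CK : forall i j s t, 0 <= s -> 0 <= t ->
      (\sum_(0 <= k <oo) (p i k s * p k j t)%:E = (p i j (s + t))%:E)%E ;
    tf_std : forall i j, p i j t @[t --> 0^'+] --> p i j 0 }.

(* q_ij = p_ij'(0+) *)
Definition has_q_matrix (R : realType) (p : nat -> nat -> R -> R)
    (q : nat -> nat -> R) : Prop :=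
  forall i j, (p i j t - p i j 0) / t @[t --> 0^'+] --> q i j.

Record equilibrium_distribution (R : realType) (p : nat -> nat -> R -> R)
    (pi : nat -> R) : Prop :=
  EquilibriumDistribution {
    eqd_ge0 : forall k, 0 <= pi k ;
    eqd_sum1 : (\sum_(0 <= k <oo) (pi k)%:E = 1)%E ;
    eqd_stat : forall j t, 0 <= t ->
      (\sum_(0 <= i <oo) (pi i * p i j t)%:E = (pi j)%:E)%E }.

(** * The q-matrices *)

Definition qstar (R : realType) (c : nat) (b : nat -> R) (i j : nat) : R :=
  if i == 0%N then 0
  else if j == i.-1 then (minn i c)%:R * b 0%N
  else if j == i then b 1%N - ((minn i c)%:R - 1) * b 0%N
  else if (i < j)%N then b (j - i + 1)%N
  else 0.

Definition qs (R : realType) (h : nat -> R) (i j : nat) : R :=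
  if i == 0%N then
    if j == 0%N then - limn (fun n => \sum_(1 <= k < n) h k) else h j
  else 0.

Definition qd (R : realType) (beta : R) (i j : nat) : R :=
  if i == 0%N then 0
  else if j == 0%N then beta
  else if j == i then - beta
  else 0.

Definition qmatrix (R : realType) (c : nat) (b h : nat -> R) (beta : R)
    (i j : nat) : R :=
  qstar c b i j + qs h i j + qd beta i j.

(** * Generating functions *)

Definition Bgf (R : realType) (b : nat -> R) (s : R) : R := limn (pseries b s).

Definition Bc (R : realType) (c : nat) (b : nat -> R) (s : R) : R :=
  Bgf b s + (c%:R - 1) * b 0%N * (1 - s).

Definition Ufun (R : realType) (c : nat) (b : nat -> R) (lambda s : R) : R :=
  Bc c b s - lambda * s.

(* The sequence h starts at index 1; the value [h 0] is never used. *)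
Definition Hgf (R : realType) (h : nat -> R) (s : R) : R :=
  limn (fun n => \sum_(1 <= j < n) h j * s ^+ j).

(* Left derivative at 1, possibly infinite. *)
Definition left_derive1 (R : realType) (f : R -> R) : \bar R :=
  lim (((f s - f 1) / (s - 1))%:E @[s --> (1 : R)^'-]).

(** * Resolvent quantities *)

Definition laplace (R : realType) (f : R -> R) (lambda : R) : R :=
  \int[@lebesgue_measure R]_(t in `[0, +oo[) (expR (- (lambda * t)) * f t).

Definition Lsum (R : realType) (h : nat -> R) (p : nat -> nat -> R -> R)
    (j : nat) (lambda : R) : R :=
  limn (fun n => \sum_(1 <= i < n) h i * laplace (p i j) lambda).

(* Main.v *)
Require Import Defs.
From HB Require Import structures.
From mathcomp Require Import all_boot all_order all_algebra.
From mathcomp Require Import all_classical all_reals all_analysis.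
From mathcomp Require Import measurable_realfun.
From mathcomp Require Import ring lra zify.

(** Write Q for the q-matrix [qmatrix], Q* for [qstar], and s |-> Pi(s) for the
   generating function [pgf] of the equilibrium distribution.  All rates are
   bounded by one constant M ([rate_bound]), so Q + M I and Q* + M I are matrices
   with nonnegative entries and bounded rows; every rearrangement of a double
   series below is an instance of Tonelli's theorem for such a matrix
   ([sums_interchange]).

   Two facts about transition functions are needed.  Letting t tend to 0 in
   pi (P(t) - I) / t = 0 gives pi Q = 0 ([equilibrium_uniformized]); the bound
   1 - p_ii(t) <= M t makes the passage to the limit legitimate.  Similarly, the
   Laplace transform Phi of P* satisfies (beta I - Q* ) Phi = I
   ([resolvent_backward]).  On the states k >= 1 the equation pi Q = 0 reads
   pi (beta I - Q* ) = pi_0 h, and multiplying it by Phi on the right yields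
   pi_k = pi_0 L_k(beta) ([pi_resolvent]).

   Multiplying the j-th equation of pi Q = 0 by s^j and summing over j gives the
   functional equation [pgf_identity]:
     (B_c(s) - beta s) (1 - Pi(s)) = (1 - pi_0) B_c(s) - s pi_0 (h - H(s))
                  - (1 - s) sum_(1 <= k < c) pi_k s^k (c - k) b_0.
   At s = u(beta) the left-hand side vanishes, and what remains is the formula for
   pi_0 ([pi0_identity]).  Divided by 1 - s, all three difference quotients at 1
   converge in the extended reals as s increases to 1, since a power series with
   nonnegative coefficients has left derivative sum_k k a_k there
   ([left_quotient_cvg]); the limit is
     beta E(N) = (1 - pi_0) B_c'(1) + pi_0 mu_1 + sum_(1 <= k < c) pi_k (c - k) b_0,
   where both sides may be infinite ([mean_formula]).  The formula for pi_0 turns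
   this into the stated expression.  Finally
   max(N - c, 0) + c = N + max(c - N, 0) gives the waiting queue
   ([waiting_mean]). *)

Set Implicit Arguments.
Unset Strict Implicit.
Unset Printing Implicit Defensive.

Import Order.TTheory GRing.Theory Num.Theory.
Import numFieldNormedType.Exports.

Local Open Scope classical_set_scope.
Local Open Scope ring_scope.

(** * Sums of real series *)

(** Convergence to a given limit is stated as a relation, so that limits are
   computed along with the series and never have to be shown to exist apart. *)
Definition sums (R : realType) (f : nat -> R) (l : R) : Prop :=
  series f @ \oo --> l.

Section Sums.
Context {R : realType}.
Implicit Types (f g : nat -> R) (l m : R).

Lemma sums_lim f l : sums f l -> limn (series f) = l.
Proof. by move=> /cvg_lim; apply. Qed.

Lemma sums_unique f l m : sums f l -> sums f m -> l = m.
Proof. by move=> /sums_lim <- /sums_lim. Qed.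

Lemma eq_sums f g l : f =1 g -> sums f l -> sums g l.
Proof. by move=> /funext ->. Qed.

Lemma sumsD f g l m :
  sums f l -> sums g m -> sums (fun k => f k + g k) (l + m).
Proof. by move=> fl gm; rewrite /sums (seriesD f g); exact: cvgD. Qed.

Lemma sumsZ c f l : sums f l -> sums (fun k => c * f k) (c * l).
Proof. by move=> fl; rewrite /sums (seriesZ f c); exact: cvgZr. Qed.

Arguments sumsZ c {f l} _.

Lemma sumsB f g l m :
  sums f l -> sums g m -> sums (fun k => f k - g k) (l - m).
Proof.
move=> fl /(sumsZ (-1)) gm; rewrite -mulN1r.
by apply: eq_sums (sumsD fl gm) => k; rewrite mulN1r.
Qed.

Lemma sums_finite n f :
  (forall k, (n <= k)%N -> f k = 0) -> sums f (\sum_(0 <= k < n) f k).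
Proof.
move=> f0; rewrite /sums -(cvg_shiftn n).
rewrite (_ : [sequence _]_m = fun=> \sum_(0 <= k < n) f k); first exact: cvg_cst.
apply/funext => m /=; rewrite seriesEnat /= (big_cat_nat _ (n := n)) ?leq_addl//=.
rewrite [X in _ + X = _]big_nat_cond [X in _ + X = _]big1 ?addr0//.
by move=> k /andP[/andP[/f0]].
Qed.

Lemma sums_delta (j : nat) (x : R) : sums (fun k => (k == j)%:R * x) x.
Proof.
have := @sums_finite j.+1 (fun k => (k == j)%:R * x).
rewrite big_nat_recr//= eqxx mul1r big_nat_cond big1 ?add0r; last first.
  by move=> k /andP[/andP[_ /ltn_eqF ->]]; rewrite mul0r.
by apply=> k /gtn_eqF ->; rewrite mul0r.
Qed.

Lemma sums_shift n f l :
  sums (fun k => f (k + n)%N) l -> sums f ((\sum_(0 <= k < n) f k) + l).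
Proof.
move=> fl; rewrite /sums -(cvg_shiftn n).
rewrite (_ : [sequence _]_m =
  (fun i => (\sum_(0 <= k < n) f k) + series (fun k => f (k + n)%N) i)).
  by apply: cvgD => //; exact: cvg_cst.
apply/funext => m /=; rewrite !seriesEnat /= (big_cat_nat _ (n := n)) ?leq_addl//=.
by rewrite -{2}[n]add0n big_addn addnK.
Qed.

Lemma sums_ge_partial f l n :
  (forall k, 0 <= f k) -> sums f l -> \sum_(0 <= k < n) f k <= l.
Proof.
move=> f0 fl; have nd : nondecreasing_seq (series f).
  by apply: nondecreasing_series => k _ _; exact: f0.
have fc : cvgn (series f) by apply/cvg_ex; exists l.
by have := nondecreasing_cvgn_le nd fc n; rewrite (sums_lim fl).
Qed.

Lemma sums_ge0 f l : (forall k, 0 <= f k) -> sums f l -> 0 <= l.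
Proof. by move=> f0 /(sums_ge_partial 0 f0); rewrite big_geq. Qed.

Lemma sums_nneseries f l : (forall k, 0 <= f k) ->
  sums f l <-> (\sum_(0 <= k <oo) (f k)%:E)%E = l%:E.
Proof.
move=> f0; have E n : (\sum_(0 <= k < n) (f k)%:E)%E = (series f n)%:E.
  by rewrite sumEFin.
rewrite /sums; split.
  move=> fl; apply/cvg_lim => //; rewrite (eq_cvg _ _ E).
  by apply/fine_cvgP; split => //; near=> n.
move=> sl; have : (\sum_(0 <= k < n) (f k)%:E)%E @[n --> \oo] --> l%:E.
  by rewrite -sl; apply: is_cvg_nneseries => k _ _; rewrite lee_fin.
by rewrite (eq_cvg _ _ E) => /fine_cvgP[_].
Unshelve. all: by end_near. Qed.

Lemma sums_dominated f g m : (forall k, 0 <= f k <= g k) -> sums g m ->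
  exists2 l, sums f l & l <= m.
Proof.
move=> fg gm.
have f0 k : 0 <= f k by have /andP[] := fg k.
have g0 k : 0 <= g k by have /andP[f0' /(le_trans f0')] := fg k.
have fc : cvgn (series f).
  apply: (@series_le_cvg _ _ g) => //.
  - by move=> k; have /andP[] := fg k.
  - by apply/cvg_ex; exists m.
exists (limn (series f)) => //; rewrite -(sums_lim gm).
apply: lim_series_le => //; first by apply/cvg_ex; exists m.
by move=> k; have /andP[] := fg k.
Qed.

Lemma sums_bounded f M : (forall k, 0 <= f k) ->
  (forall n, \sum_(0 <= k < n) f k <= M) -> exists2 l, sums f l & l <= M.
Proof.
move=> f0 fM; have fc : cvgn (series f).
  apply: nondecreasing_is_cvgn.
    by apply: nondecreasing_series => k _ _; exact: f0.
  by exists M => _ [n _ <-]; exact: fM.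
by exists (limn (series f)) => //; apply: limr_le => //; near=> n; exact: fM.
Unshelve. all: by end_near. Qed.

(** Tonelli's theorem; convergence of the series of column sums is part of the
   conclusion. *)
Lemma sums_interchange (a : nat -> nat -> R) (r c : nat -> R) l :
  (forall i j, 0 <= a i j) ->
  (forall i, sums (a i) (r i)) -> (forall j, sums (a^~ j) (c j)) ->
  sums r l -> sums c l.
Proof.
move=> a0 ar ac rl.
have r0 i : 0 <= r i by exact: sums_ge0 (ar i).
have c0 j : 0 <= c j by exact: sums_ge0 (ac j).
apply/sums_nneseries => //; move/sums_nneseries : rl => <- //.
have -> : (\sum_(0 <= i <oo) (r i)%:E)%E =
          (\sum_(0 <= i <oo) \sum_(0 <= j <oo) (a i j)%:E)%E.
  by apply: eq_eseriesr => i _; symmetry; apply/sums_nneseries.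
rewrite nneseries_interchange; last by move=> i j; rewrite lee_fin.
by apply: eq_eseriesr => j _; symmetry; apply/sums_nneseries.
Qed.

Lemma cvg_partial_sum {T : Type} (F : set_system T) {FF : Filter F}
    (a : nat -> T -> R) (a' : nat -> R) (s : seq nat) :
  (forall k, a k t @[t --> F] --> a' k) ->
  \sum_(k <- s) a k t @[t --> F] --> \sum_(k <- s) a' k.
Proof.
move=> aa; elim: s => [|k s IH].
  rewrite big_nil (_ : (fun _ => _) = fun=> 0); first exact: cvg_cst.
  by apply/funext => t; rewrite big_nil.
rewrite big_cons (_ : (fun _ => _) =
    a k + (fun t => \sum_(k <- s) a k t)); first exact: cvgD.
by apply/funext => t; rewrite big_cons.
Qed.

(** Limits pass through a series of products when no mass of the weights is lost:
   the mass [A t] bounds all partial sums of [w t] and tends to the full mass of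
   the limit weights.  The partial sums of the limit series then differ from [C']
   by at most [K] times the tail of [w'].  This contains both dominated convergence
   (constant [w]) and Scheffe's lemma (constant [x]). *)
Lemma sums_limit {T : topologicalType} (F : set_system T) {FF : ProperFilter F}
    (w x : T -> nat -> R) (A C : T -> R) (w' x' : nat -> R) (K A' C' : R) :
  (\forall t \near F, forall k, 0 <= w t k) ->
  (\forall t \near F, forall k, 0 <= x t k <= K) ->
  (forall k, w t k @[t --> F] --> w' k) ->
  (forall k, x t k @[t --> F] --> x' k) ->
  (\forall t \near F, forall n, \sum_(0 <= k < n) w t k <= A t) ->
  A t @[t --> F] --> A' -> sums w' A' ->
  (\forall t \near F, sums (fun k => w t k * x t k) (C t)) ->
  C t @[t --> F] --> C' ->
  sums (fun k => w' k * x' k) C'.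
Proof.
move=> w0 xK ww xx wA AA wA' CC CC'.
have E (n : nat) : 0 <= C' - \sum_(0 <= k < n) w' k * x' k
    <= K * (A' - \sum_(0 <= k < n) w' k).
  have cw : (C t - \sum_(0 <= k < n) w t k * x t k) @[t --> F] -->
      C' - \sum_(0 <= k < n) w' k * x' k.
    apply: cvgB => //; apply: cvg_partial_sum => k; exact: cvgM.
  have cA : K * (A t - \sum_(0 <= k < n) w t k) @[t --> F] -->
      K * (A' - \sum_(0 <= k < n) w' k).
    apply: cvgM; first exact: cvg_cst.
    by apply: cvgB => //; exact: cvg_partial_sum.
  apply/andP; split.
    apply: (cvgr_to_ge cw); near=> t; rewrite subr_ge0.
    apply: sums_ge_partial; last by near: t.
    move=> k; apply: mulr_ge0; first by move: k; near: t.
    by have /(_ k)/andP[] : forall k, 0 <= x t k <= K by near: t.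
  apply: ler_cvg_to cw cA _; near=> t.
  have w0t : forall k, 0 <= w t k by near: t.
  have xKt : forall k, 0 <= x t k <= K by near: t.
  have wAt : forall n, \sum_(0 <= k < n) w t k <= A t by near: t.
  have CCt : sums (fun k => w t k * x t k) (C t) by near: t.
  rewrite lerBlDr; apply: (cvgr_to_le CCt); exists n => // m /= nm.
  rewrite seriesEnat /= (big_cat_nat _ (n := n)) //= addrC lerD2r.
  apply: (@le_trans _ _ (K * \sum_(n <= k < m) w t k)).
    rewrite mulr_sumr; apply: ler_sum => k _.
    by rewrite mulrC ler_wpM2r//; have /andP[] := xKt k.
  apply: ler_wpM2l; first by have /andP[x0 /(le_trans x0)] := xKt 0%N.
  by rewrite lerBrDl -big_cat_nat.
rewrite /sums.
have : (fun n => C' - K * (A' - series w' n)) @ \oo --> C' - K * (A' - A').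
  by apply: cvgB; [exact: cvg_cst|apply: cvgM; [exact: cvg_cst|
    apply: cvgB => //; exact: cvg_cst]].
rewrite subrr mulr0 subr0 => cl.
apply: squeeze_cvgr cl (cvg_cst C'); near=> n.
have := E n; rewrite !seriesEnat /= => /andP[]; rewrite subr_ge0 => -> E2.
by rewrite andbT lerBlDr -lerBlDl.
Unshelve. all: by end_near. Qed.

End Sums.

Arguments sumsZ {R} c {f l} _.
Arguments sums_delta {R} j x.

(** * Left derivatives of generating functions at 1 *)

Section LeftDerivative.
Context {R : realType} (a : nat -> R) (A : R) (f : R -> R).
Hypotheses (a_ge0 : forall k, 0 <= a k) (aA : sums a A).
Hypothesis af : forall s, 0 <= s <= 1 -> sums (fun k => a k * s ^+ k) (f s).

Let natr_sum1 k : k%:R = \sum_(0 <= i < k) (1 : R).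
Proof. by rewrite big_const_nat subn0 iter_addr_0. Qed.

Let quotient_sums s : 0 <= s < 1 ->
  sums (fun k => a k * \sum_(0 <= i < k) s ^+ i) ((A - f s) / (1 - s)).
Proof.
move=> /andP[s0 s1]; have s01 : 0 <= s <= 1 by rewrite s0 ltW.
rewrite mulrC; apply: eq_sums (sumsZ (1 - s)^-1 (sumsB aA (af s01))) => k.
have -> : a k - a k * s ^+ k = (1 - s) * (a k * \sum_(0 <= i < k) s ^+ i).
  by rewrite big_mkord; have := subrX1 s k => H; rewrite mulrCA -[1 - s]opprB mulNr -H; ring.
by rewrite mulKf// subr_eq0 gt_eqF.
Qed.

(** The quotient is the series of the [a k * (1 + s + ... + s ^+ (k - 1))], which
   increases with [s] to the series of the [k%:R * a k].  The limit may be
   infinite, so the argument is that every real number below it is eventually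
   exceeded, already by a partial sum. *)
Lemma left_quotient_cvg :
  ((A - f s) / (1 - s))%:E @[s --> 1^'-] -->
  (\sum_(0 <= k <oo) (k%:R * a k)%:E)%E.
Proof.
have ka0 k : 0 <= k%:R * a k by rewrite mulr_ge0.
set L := (\sum_(0 <= k <oo) _)%E.
have L0 : (0 <= L)%E by apply: nneseries_ge0 => k _ _; rewrite lee_fin.
have low y : (y%:E < L)%E -> \forall s \near 1^'-, y < (A - f s) / (1 - s).
  move=> yL; have [n yn] : exists n, y < \sum_(0 <= k < n) k%:R * a k.
    apply: contrapT => /forallNP yn.
    have {}yn n : \sum_(0 <= k < n) k%:R * a k <= y.
      by rewrite leNgt; apply/negP; exact: yn.
    have [l Ls ly] := sums_bounded ka0 yn.
    have Ll : L = l%:E by apply/(sums_nneseries _ ka0).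
    by move: yL; rewrite Ll lte_fin ltNge ly.
  have pn : \sum_(0 <= k < n) a k * (\sum_(0 <= i < k) s ^+ i) @[s --> 1^'-]
      --> \sum_(0 <= k < n) k%:R * a k.
    apply: (cvg_partial_sum (a := fun k s => a k * (\sum_(0 <= i < k) s ^+ i))) => k.
    rewrite mulrC; apply: cvgM; first exact: cvg_cst.
    rewrite natr_sum1.
    apply: (cvg_partial_sum (a := fun i s => s ^+ i) (a' := fun=> 1)) => i.
    apply: cvg_at_left_filter; rewrite -[X in _ --> X](expr1n _ i).
    exact: exprn_continuous.
  have pny := @cvgr_gt _ _ _ _ _ _ pn _ yn.
  near=> s; apply: (@lt_le_trans _ _ (\sum_(0 <= k < n) a k * (\sum_(0 <= i < k) s ^+ i))).
    by near: s; exact: pny.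
  have s0 : 0 <= s by near: s; exact: nbhs_left_ge.
  have s1 : s < 1 by near: s; exact: nbhs_left_lt.
  apply: sums_ge_partial; last by apply: quotient_sums; rewrite s0 s1.
  by move=> k; rewrite mulr_ge0// sumr_ge0// => i _; rewrite exprn_ge0.
have [Ly|[l Ll]] : L = +oo%E \/ exists l, L = l%:E.
  case: L L0 {low} => [l|//|//] _; [by right; exists l|by left].
  rewrite Ly; apply/cvgeryP/cvgryPgt => y; apply: low; rewrite Ly; exact: ltry.
rewrite Ll; apply: cvg_EFin; first exact: nearW.
have Ls : sums (fun k => k%:R * a k) l by apply/sums_nneseries.
apply/cvgrPdist_le => e e0.
have /low le_near : ((l - e)%:E < L)%E by rewrite Ll lte_fin ltrBlDr ltrDl.
near=> s; have ls : l - e < (A - f s) / (1 - s) by near: s; exact: le_near.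
have s01 : 0 <= s < 1.
  by apply/andP; split; near: s; [exact: nbhs_left_ge|exact: nbhs_left_lt].
have : (A - f s) / (1 - s) <= l.
  have := sums_ge0 _ (sumsB Ls (quotient_sums s01)); rewrite subr_ge0; apply=> k.
  rewrite mulrC -mulrBr mulr_ge0// subr_ge0.
  have /andP[s0 s1] := s01.
  by rewrite natr_sum1; apply: ler_sum => i _; apply: exprn_ile1 => //; exact: ltW.
by move=> Dl; rewrite ger0_norm ?subr_ge0//=; lra.
Unshelve. all: by end_near. Qed.

End LeftDerivative.

Lemma expectation_nat (R : realType) d (T : measurableType d)
    (P : probability T R) (N : {RV P >-> nat}) (w : nat -> R) (g : nat -> R) :
  (forall k, distribution P N [set k] = (w k)%:E) -> (forall k, 0 <= g k) ->
  ('E_P[fun x => g (N x)] = \sum_(0 <= k <oo) (g k * w k)%:E)%E.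
Proof.
move=> Nw g0.
have mg D : measurable_fun D (EFin \o g) by move=> mD Y mY.
rewrite unlock.
transitivity (\int[distribution P N]_y (EFin \o g) y)%E.
  by rewrite ge0_integral_distribution.
have -> : [set: nat] = \bigcup_k [set k] by apply/seteqP; split => // k _; exists k.
rewrite ge0_integral_bigcup//; last 2 first.
- by move=> x _; rewrite lee_fin.
- by move=> i j _ _ [x [/= -> ->]].
apply: eq_eseriesr => k _.
rewrite (eq_integral (cst (g k)%:E)); last first.
  by move=> x; rewrite inE /= => ->.
rewrite integral_cst// EFinM; congr (_ * _)%E; exact: Nw.
Qed.

(** * Transition functions with bounded rates *)

(** When [M] bounds all exit rates, adding [M] on the diagonal makes every entry of
   a q-matrix nonnegative. *)
Definition uniformized (R : realType) (M : R) (q : nat -> nat -> R)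
    (i j : nat) : R := q i j + M * (i == j)%:R.

Section TransitionFunctions.
Context {R : realType} {p : nat -> nat -> R -> R}.
Hypothesis p_tf : transition_function p.

Lemma tf_sums_row i t : 0 <= t -> exists2 l, sums (fun k => p i k t) l & l <= 1.
Proof.
move=> t0; apply: sums_bounded => [k|n]; first exact: (tf_ge0 p_tf).
rewrite -lee_fin; apply: le_trans (tf_le1 p_tf i t0).
rewrite -sumEFin; apply: nneseries_lim_ge => k _ _.
by rewrite lee_fin (tf_ge0 p_tf).
Qed.

Lemma tf_sums_CK i j s t : 0 <= s -> 0 <= t ->
  sums (fun k => p i k s * p k j t) (p i j (s + t)).
Proof.
move=> s0 t0; apply/sums_nneseries; last exact: (tf_CK p_tf).
by move=> k; rewrite mulr_ge0// (tf_ge0 p_tf).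
Qed.

Lemma tf_sum_row_le1 i n t : 0 <= t -> \sum_(0 <= k < n) p i k t <= 1.
Proof.
move=> t0; have [l pl l1] := tf_sums_row i t0.
by apply: le_trans l1; apply: sums_ge_partial pl => k; exact: (tf_ge0 p_tf).
Qed.

Lemma tf_two_le1 i j t : 0 <= t -> i != j -> p i i t + p i j t <= 1.
Proof.
move=> t0 ij; have [l pl l1] := tf_sums_row i t0; apply: le_trans l1.
have : sums (fun k => p i k t - ((k == i)%:R * p i i t + (k == j)%:R * p i j t))
    (l - (p i i t + p i j t)).
  by apply: sumsB => //; apply: sumsD; exact: sums_delta.
move=> /sums_ge0; rewrite subr_ge0; apply=> k.
have [->|ki] := eqVneq k i; first by rewrite (negbTE ij) !(mul1r, mul0r, addr0) subrr.
have [->|kj] := eqVneq k j; first by rewrite !(mul1r, mul0r, add0r) subrr.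
by rewrite !mul0r addr0 subr0 (tf_ge0 p_tf).
Qed.

Lemma tf_le1_entry i j t : 0 <= t -> p i j t <= 1.
Proof.
move=> t0; have [<-|ij] := eqVneq i j.
  have /(_ i.+1) := tf_sum_row_le1 i _ t0; rewrite big_nat_recr//=.
  by apply: le_trans; rewrite lerDr sumr_ge0// => k _; exact: (tf_ge0 p_tf).
by apply: le_trans (tf_two_le1 t0 ij); rewrite lerDr (tf_ge0 p_tf).
Qed.

Lemma tf_increment_ge i j s t : 0 <= s -> 0 <= t ->
  p i i s * p i j t <= p i j (s + t).
Proof.
move=> s0 t0.
have : sums (fun k => p i k s * p k j t - (k == i)%:R * (p i i s * p i j t))
    (p i j (s + t) - p i i s * p i j t).
  by apply: sumsB; [exact: tf_sums_CK|exact: sums_delta].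
move=> /sums_ge0; rewrite subr_ge0; apply=> k.
have [->|ki] := eqVneq k i; first by rewrite mul1r subrr.
by rewrite mul0r subr0 mulr_ge0// (tf_ge0 p_tf).
Qed.

Lemma tf_increment_le i j s t : 0 <= s -> 0 <= t ->
  p i j (s + t) <= p i i s * p i j t + (1 - p i i s).
Proof.
move=> s0 t0; have [l pl l1] := tf_sums_row i s0.
have : sums (fun k => p i k s - p i k s * p k j t
    - (k == i)%:R * (p i i s - p i i s * p i j t))
    (l - p i j (s + t) - (p i i s - p i i s * p i j t)).
  apply: sumsB; last exact: sums_delta.
  by apply: sumsB => //; exact: tf_sums_CK.
move=> /sums_ge0 H; suff : 0 <= l - p i j (s + t) - (p i i s - p i i s * p i j t).
  by lra.
apply: H => k; have [->|ki] := eqVneq k i; first by rewrite mul1r subrr.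
rewrite mul0r subr0 subr_ge0 ler_piMr// ?(tf_ge0 p_tf)//.
exact: tf_le1_entry.
Qed.

Lemma tf_increment i j s t : 0 <= s -> 0 <= t ->
  `|p i j (s + t) - p i j t| <= 1 - p i i s.
Proof.
move=> s0 t0; have := tf_increment_ge i j s0 t0; have := tf_increment_le i j s0 t0.
have := tf_ge0 p_tf i j t0; have := tf_le1_entry i j t0.
have := tf_ge0 p_tf i i s0; have := tf_le1_entry i i s0.
move: (p i j (s + t)) (p i j t) (p i i s) => x y z.
by rewrite ler_norml => *; apply/andP; split; nra.
Qed.

Context {q : nat -> nat -> R}.
Hypothesis p_q : has_q_matrix p q.

Lemma tf_exit_subadd i n t : 0 <= t ->
  1 - p i i (n%:R * t) <= n%:R * (1 - p i i t).
Proof.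
move=> t0; elim: n => [|n IH].
  by rewrite !mul0r (tf_id p_tf) eqxx subrr.
have nt0 : 0 <= n%:R * t by rewrite mulr_ge0.
have := tf_increment_ge i i nt0 t0.
have -> : n.+1%:R * t = n%:R * t + t by rewrite -natr1 mulrDl mul1r.
have := tf_ge0 p_tf i i nt0; have := tf_le1_entry i i nt0.
have := tf_ge0 p_tf i i t0; have := tf_le1_entry i i t0.
rewrite -natr1 mulrDl mul1r.
move: (n%:R * (1 - _)) IH => y; move: (p i i (_ + _)) (p i i (_ * _)) (p i i t) => u v w.
by move=> *; nra.
Qed.

(** The function [f t := 1 - p i i t] is subadditive, so [f t / t] is at most
   [f (t / n) / (t / n)] for every [n], and this tends to [- q i i]. *)
Lemma tf_exit_le i t : 0 <= t -> 1 - p i i t <= - q i i * t.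
Proof.
rewrite le_eqVlt => /predU1P[<-|t0].
  by rewrite (tf_id p_tf) eqxx subrr mulr0.
have pq : (p i i t - p i i 0) / t @[t --> 0^'+] --> q i i by exact: p_q.
have t_cvg : (fun n : nat => t / n.+1%:R) @ \oo --> (0 : R).
  by rewrite -(mulr0 t); apply: cvgM; [exact: cvg_cst|exact: cvg_harmonic].
have : (p i i (t / n.+1%:R) - p i i 0) / (t / n.+1%:R) @[n --> \oo] --> q i i.
  move: pq => /cvg_at_rightP; apply; split=> // n.
  by rewrite divr_gt0.
move=> /cvgr_to_le => /(_ ((p i i t - 1) / t)) H.
have : q i i <= (p i i t - 1) / t.
  apply: H; near=> n; rewrite (tf_id p_tf) eqxx (_ : true%:R = 1)//.
  have tn0 : 0 < t / n.+1%:R by rewrite divr_gt0.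
  have := tf_exit_subadd i n.+1 (ltW tn0).
  rewrite [n.+1%:R * (t / _)]mulrC divfK//.
  set x := p i i (t / _) => xt.
  rewrite invf_div mulrA ler_pM2r ?invr_gt0//; lra.
rewrite ler_pdivlMr//; lra.
Unshelve. all: by end_near. Qed.

Lemma qmatrix_offdiag_ge0 i j : i != j -> 0 <= q i j.
Proof.
move=> ij; have pq : (p i j t - p i j 0) / t @[t --> 0^'+] --> q i j by exact: p_q.
apply: (cvgr_to_ge pq); near=> t.
rewrite (tf_id p_tf) (negbTE ij) subr0 divr_ge0// (tf_ge0 p_tf)//.
Unshelve. all: by end_near. Qed.

Context {M : R}.
Hypothesis q_le : forall i, - q i i <= M.

Lemma uniformized_ge0 i j : 0 <= uniformized M q i j.
Proof.
rewrite /uniformized; have [->|ij] := eqVneq i j.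
  by rewrite mulr1; have := q_le j; lra.
by rewrite mulr0 addr0 qmatrix_offdiag_ge0.
Qed.

Lemma tf_exit_leM i t : 0 <= t -> 1 - p i i t <= M * t.
Proof. by move=> t0; apply: le_trans (tf_exit_le i t0) _; rewrite ler_wpM2r. Qed.

(** The bounds are uniform in [i] and [t], which is what the limits [t --> 0]
   in the equilibrium and backward equations require. *)
Lemma uniformized_quotient_itv i j t : 0 < t ->
  0 <= (p i j t - p i j 0) / t + M * (i == j)%:R <= M.
Proof.
move=> t0; have t0' := ltW t0; rewrite (tf_id p_tf).
have := tf_exit_leM i t0'.
have [<-|ij] := eqVneq i j => H.
  rewrite mulr1 (_ : true%:R = 1)// gerDr pmulr_lle0 ?invr_gt0// subr_le0.
  rewrite tf_le1_entry// andbT -lerBlDr sub0r ler_pdivlMr//; lra.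
rewrite subr0 mulr0 addr0 divr_ge0 ?(tf_ge0 p_tf)//= ler_pdivrMr//.
by have := tf_two_le1 t0' ij; lra.
Qed.

Lemma uniformized_quotient_cvg i j :
  (p i j t - p i j 0) / t + M * (i == j)%:R @[t --> 0^'+] --> uniformized M q i j.
Proof. by apply: cvgD; [exact: p_q|exact: cvg_cst]. Qed.

(** The equation pi Q = 0, as pi (Q + M I) = M pi. *)
Lemma equilibrium_uniformized pi j : equilibrium_distribution p pi ->
  sums (fun i => pi i * uniformized M q i j) (M * pi j).
Proof.
move=> [pi0 pi1 pi_stat].
have pis : sums pi 1 by apply/sums_nneseries.
apply: (@sums_limit R R (0^'+)%R _ (fun=> pi)
  (fun t i => (p i j t - p i j 0) / t + M * (i == j)%:R)
  (fun=> 1) (fun=> M * pi j) _ _ M 1) => //.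
- by near=> t.
- near=> t => i; exact: uniformized_quotient_itv.
- by move=> k; exact: cvg_cst.
- by move=> i; exact: uniformized_quotient_cvg.
- by near=> t => n; exact: sums_ge_partial pis.
- exact: cvg_cst.
- near=> t; have t0 : 0 <= t by [].
  have : sums (fun i => t^-1 * (pi i * p i j t - (i == j)%:R * pi j)
      + (i == j)%:R * (M * pi j)) (t^-1 * (pi j - pi j) + M * pi j).
    apply: sumsD; last exact: sums_delta.
    apply: sumsZ; apply: sumsB; last exact: sums_delta.
    by apply/sums_nneseries => [k|]; [rewrite mulr_ge0// (tf_ge0 p_tf)|exact: pi_stat].
  rewrite subrr mulr0 add0r; apply: eq_sums => i; rewrite (tf_id p_tf).
  have [->|ij] := eqVneq i j; rewrite ?mul1r ?mul0r ?(mulr1n,mulr0n); by ring.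
- exact: cvg_cst.
Unshelve. all: by end_near. Qed.

(** Kolmogorov's backward equation applied to a bounded function [x]: the
   derivative at 0 of the semigroup acting on [x] is Q x.  Row conservativity
   [sums (q i) 0] ensures that the mass of row [i] of the difference quotient
   converges to that of row [i] of Q. *)
Lemma backward_uniformized i (x : nat -> R) (K : R) (C : R -> R) C' :
  sums (q i) 0 -> (forall k, 0 <= x k <= K) ->
  (forall t, 0 < t -> sums (fun k => p i k t * x k) (C t)) ->
  (C t - x i) / t @[t --> 0^'+] --> C' ->
  sums (fun k => uniformized M q i k * x k) (C' + M * x i).
Proof.
move=> qi0 xK CC CC'.
apply: (@sums_limit R R (0^'+)%R _
  (fun t k => (p i k t - p i k 0) / t + M * (i == k)%:R) (fun=> x)
  (fun=> M) (fun t => (C t - x i) / t + M * x i) _ _ K M).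
- near=> t => k; have /andP[//] : 0 <= (p i k t - p i k 0) / t + M * (i == k)%:R <= M.
  exact: uniformized_quotient_itv.
- exact: nearW.
- by move=> k; exact: uniformized_quotient_cvg.
- by move=> k; exact: cvg_cst.
- near=> t => n; have t0 : 0 <= t by [].
  have [l pl l1] := tf_sums_row i t0.
  have ws : sums (fun k => (p i k t - p i k 0) / t + M * (i == k)%:R)
     (t^-1 * (l - 1) + M).
    have : sums (fun k => t^-1 * (p i k t - (k == i)%:R * 1) + (k == i)%:R * M)
        (t^-1 * (l - 1) + M).
      apply: sumsD; last exact: sums_delta.
      by apply: sumsZ; apply: sumsB => //; exact: sums_delta.
    apply: eq_sums => k; rewrite (tf_id p_tf) [k == i]eq_sym; by ring.
  apply: (@le_trans _ _ (t^-1 * (l - 1) + M)).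
    apply: sums_ge_partial ws => k.
    have /andP[//] : 0 <= (p i k t - p i k 0) / t + M * (i == k)%:R <= M.
    exact: uniformized_quotient_itv.
  by rewrite gerDr mulr_ge0_le0// ?invr_ge0// subr_le0.
- exact: cvg_cst.
- have : sums (fun k => q i k + (k == i)%:R * M) (0 + M).
    by apply: sumsD => //; exact: sums_delta.
  by rewrite add0r; apply: eq_sums => k; rewrite /uniformized mulrC [k == i]eq_sym.
- near=> t; have t0 : 0 < t by [].
  have : sums (fun k => t^-1 * (p i k t * x k - (k == i)%:R * x i)
      + (k == i)%:R * (M * x i)) (t^-1 * (C t - x i) + M * x i).
    apply: sumsD; last exact: sums_delta.
    by apply: sumsZ; apply: sumsB; [exact: CC|exact: sums_delta].
  rewrite [t^-1 * _]mulrC; apply: eq_sums => k; rewrite (tf_id p_tf) [k == i]eq_sym.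
  have [->|ij] := eqVneq i k; rewrite ?(mulr1n,mulr0n); by ring.
- by apply: cvgD => //; exact: cvg_cst.
Unshelve. all: by end_near. Qed.

Lemma tf_lipschitz i j s t : 0 <= s -> 0 <= t ->
  `|p i j s - p i j t| <= M * `|s - t|.
Proof.
wlog ts : s t / t <= s.
  by move=> H s0 t0; case: (leP t s) => [|/ltW] st; [exact: H|
    rewrite distrC [`|s - t|]distrC; exact: H].
move=> s0 t0; have st0 : 0 <= s - t by rewrite subr_ge0.
rewrite [`|s - t|]ger0_norm//; apply: le_trans (tf_exit_leM i st0).
by have := tf_increment i j st0 t0; rewrite subrK.
Qed.

End TransitionFunctions.

(** * Laplace transforms *)

Section Laplace.
Context {R : realType} (lambda : R).
Hypothesis lambda_gt0 : 0 < lambda.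
Notation mu := (@lebesgue_measure R).
Implicit Type f : R -> R.

Let E (t : R) : R := expR (- (lambda * t)).

Let E_gt0 t : 0 < E t. Proof. exact: expR_gt0. Qed.

Let E_continuous : continuous E.
Proof.
move=> z; apply: continuous_comp; last exact: continuous_expR.
by apply: continuousN; apply: continuousM => //; exact: cst_continuous.
Qed.

Let discounted_continuous f : continuous f -> continuous (fun t => E t * f t).
Proof. by move=> cf z; apply: continuousM; [exact: E_continuous|exact: cf]. Qed.

Lemma discounted_measurable f D : continuous f -> measurable D ->
  measurable_fun D (fun t => expR (- (lambda * t)) * f t).
Proof.
move=> cf mD; apply: measurable_funTS; apply: continuous_measurable_fun.
exact: discounted_continuous.
Qed.

Lemma integral_discount :
  (\int[mu]_(t in `[0%R, +oo[) (expR (- (lambda * t)))%:E = (lambda^-1)%:E)%E.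
Proof.
have := integral_exponential_pdf lambda_gt0.
have -> : (\int[mu]_x (exponential_pdf lambda x)%:E =
   \int[mu]_(x in `[0%R, +oo[) (lambda%:E * (E x)%:E))%E.
  rewrite [RHS]integral_mkcond; apply: eq_integral => x _.
  rewrite /exponential_pdf !patchE; case: ifP => // _.
  by rewrite /E mulNr.
rewrite ge0_integralZl//; last 3 first.
- apply/measurable_EFinP; apply: measurable_funTS.
  exact: continuous_measurable_fun.
- by move=> x _; rewrite lee_fin ltW.
- by rewrite lee_fin ltW.
rewrite -/E; set I := (\int[mu]_(x in _) _)%E => lI.
have : ((lambda^-1)%:E * (lambda%:E * I) = (lambda^-1)%:E)%E by rewrite lI mule1.
by rewrite muleA -EFinM mulVf ?gt_eqF// mul1e.
Qed.

Section Bounded.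
Context (f : R -> R).
Hypotheses (cf : continuous f) (f01 : forall t, 0 <= f t <= 1).

Let discounted_ge0 t : 0 <= E t * f t.
Proof. by rewrite mulr_ge0 ?(ltW (E_gt0 t))//; have /andP[] := f01 t. Qed.

Let discounted_le t : E t * f t <= E t.
Proof. by rewrite ler_piMr ?(ltW (E_gt0 t))//; have /andP[] := f01 t. Qed.

Let integral_discounted_le :
  (\int[mu]_(t in `[0%R, +oo[) (E t * f t)%:E <= (lambda^-1)%:E)%E.
Proof.
rewrite -integral_discount; apply: ge0_le_integral => //.
- by move=> t _; rewrite lee_fin.
- by apply/measurable_EFinP; exact: discounted_measurable.
- apply/measurable_EFinP; apply: measurable_funTS.
  exact: continuous_measurable_fun.
- by move=> t _; rewrite lee_fin.
Qed.

Let integral_discounted_ge0 D :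
  (0 <= \int[mu]_(t in D) (E t * f t)%:E)%E.
Proof. by apply: integral_ge0 => t _; rewrite lee_fin. Qed.

Lemma laplace_integral :
  (\int[mu]_(t in `[0%R, +oo[) (expR (- (lambda * t)) * f t)%:E
   = (laplace f lambda)%:E)%E.
Proof.
rewrite fineK// ge0_fin_numE; last exact: integral_discounted_ge0.
exact: le_lt_trans integral_discounted_le (ltry _).
Qed.

Lemma laplace_itv : 0 <= laplace f lambda <= lambda^-1.
Proof.
by rewrite -!lee_fin -laplace_integral integral_discounted_ge0.
Qed.

Lemma integrable_discounted :
  mu.-integrable `[0%R, +oo[ (EFin \o (fun t => expR (- (lambda * t)) * f t)).
Proof.
apply/integrableP; split.
  by apply/measurable_EFinP; exact: discounted_measurable.
rewrite [ltLHS](_ : _ = (laplace f lambda)%:E) ?ltry// -laplace_integral.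
by apply: eq_integral => t _ /=; rewrite ger0_norm ?discounted_ge0.
Qed.

Lemma integrable_discounted_itv (a b : R) :
  mu.-integrable `[a, b] (EFin \o (fun t => expR (- (lambda * t)) * f t)).
Proof.
apply: continuous_compact_integrable; first exact: segment_compact.
apply: continuous_subspaceT.
exact: discounted_continuous.
Qed.

End Bounded.

Section Shift.
Context (f : R -> R).
Hypotheses (cf : continuous f) (f01 : forall t, 0 <= f t <= 1).

Let discounted_ge0 t : 0 <= E t * f t.
Proof. by rewrite mulr_ge0 ?(ltW (E_gt0 t))//; have /andP[] := f01 t. Qed.

(** Substitution [t := t + s] in the integral defining the transform of [f]. *)
Lemma laplace_shift s : 0 <= s ->
  laplace (fun t => f (s + t)) lambda
  = expR (lambda * s) * (laplace f lambda
       - \int[mu]_(t in `[0, s]) (expR (- (lambda * t)) * f t)).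
Proof.
move=> s0.
rewrite {2}/laplace Rintegral_itvB ?bnd_simp//; last first.
  exact: integrable_discounted.
rewrite Rintegral_itv_obnd_cbnd; last first.
  apply: integrableS (integrable_discounted cf f01) => //.
  by apply: subset_itvr; rewrite bnd_simp.
have -> : \int[mu]_(x in `[s, +oo[) (expR (- (lambda * x)) * f x) =
  \int[mu]_(t in `[0, +oo[) (expR (- (lambda * s)) * (E t * f (s + t))).
  rewrite /Rintegral; congr fine.
  have Efs t : E (t + s) * f (t + s) = E s * (E t * f (s + t)).
    rewrite /E mulrA -expRD [t + s]addrC mulrDr opprD; reflexivity.
  have dF : derive1 (fun t : R => t + s) = cst 1.
    by apply/funext => t; rewrite derive1E deriveD// derive_id derive_cst addr0.
  have := @increasing_ge0_integration_by_substitutiony R (fun t => t + s)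
    (fun t => E t * f t) 0.
  rewrite add0r dF => ->.
  - apply: eq_integral => t _; congr EFin; rewrite !fctE /= mulr1.
    exact: Efs.
  - by move=> x y _ _; rewrite ltrD2r.
  - by move=> x _; exact: cst_continuous.
  - exact: is_cvg_cst.
  - exact: is_cvg_cst.
  - split; first by move=> x _; exact: derivableD.
    apply: cvg_at_right_filter.
    by apply: continuousD; [exact: cvg_id|exact: cst_continuous].
  - exact: cvg_addrr.
  - apply: continuous_subspaceT.
    exact: discounted_continuous.
  - by move=> x _; exact: discounted_ge0.
rewrite RintegralZl//.
  by rewrite mulrA -expRD subrr expR0 mul1r.
apply: (@integrable_discounted (fun t => f (s + t))) => // z.
apply: (@continuous_comp _ _ _ (fun t => s + t) f); last exact: cf.
by apply: continuousD; [exact: cst_continuous|exact: cvg_id].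
Qed.

(** By [laplace_shift] this is the right derivative at [s = 0] of the transform of
   the shifted function [fun t => f (s + t)]. *)
Lemma laplace_shift_derivative :
  (expR (lambda * s) * (laplace f lambda
       - \int[mu]_(t in `[0, s]) (expR (- (lambda * t)) * f t))
    - laplace f lambda) / s @[s --> 0^'+] --> lambda * laplace f lambda - f 0.
Proof.
(* Starting the integral at -1 makes 0 an interior point for the fundamental
   theorem of calculus. *)
pose F (s : R) := \int[mu]_(t in `[-1, s]) (E t * f t).
have [dF F'] : derivable F 0 1 /\ derive1 F 0 = E 0 * f 0.
  apply: (@continuous_FTC1_closed R (fun t => E t * f t) (-1) 0 1) => //.
  - exact: integrable_discounted_itv.
  - exact: (discounted_continuous cf).
have FE s : 0 <= s -> \int[mu]_(t in `[0, s]) (E t * f t) = F s - F 0.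
  move=> s0; rewrite /F Rintegral_itvB ?bnd_simp//; last first.
    exact: integrable_discounted_itv.
  rewrite Rintegral_itv_obnd_cbnd//.
  apply: integrableS (integrable_discounted_itv cf 0 s) => //.
  by apply: subset_itvr; rewrite bnd_simp.
pose G (s : R) := expR (lambda * s) * (laplace f lambda - (F s - F 0)).
have G0 : G 0 = laplace f lambda.
  by rewrite /G mulr0 expR0 mul1r subrr subr0.
have isF : is_derive (0 : R) (1 : R) F (f 0).
  apply: DeriveDef => //; rewrite -derive1E F'.
  by rewrite /E mulr0 oppr0 expR0 mul1r.
have isG : is_derive (0 : R) (1 : R) G (lambda * laplace f lambda - f 0).
  have isE : is_derive (0 : R) (1 : R) (fun s => expR (lambda * s)) lambda.
    have isL : is_derive (0 : R) (1 : R) ( *%R lambda) lambda.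
      apply: (is_derive_eq (is_deriveZ lambda (is_derive_id _ _))).
      by rewrite /GRing.scale/= mulr1.
    apply: (is_derive_eq (is_derive1_comp (is_derive_expR (lambda * 0)) isL)).
    by rewrite mulr0 expR0 mul1r.
  have isD : is_derive (0 : R) (1 : R) (fun s => laplace f lambda - (F s - F 0))
     (0 - (f 0 - 0)).
    by apply: is_deriveB.
  apply: (is_derive_eq (is_deriveM isE isD)).
  rewrite subrr subr0 mulr0 expR0 scale1r /GRing.scale /=; ring.
have dG : h^-1 *: ((G \o shift 0) (h *: 1) - G 0) @[h --> 0^'] -->
    lambda * laplace f lambda - f 0.
  rewrite -[X in _ --> X](@derive_val _ _ _ _ _ _ _ isG).
  exact: (@ex_derive _ _ _ _ _ _ _ isG).
apply: cvg_trans (cvg_dnbhs_at_right dG); apply: near_eq_cvg; near=> s.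
have s0 : 0 <= s by [].
by rewrite /= FE// G0 /GRing.scale /= mulr1 addr0 [RHS]mulrC.
Unshelve. all: by end_near. Qed.

End Shift.
End Laplace.

(** * The resolvent of a transition function *)

Section Resolvent.
Context {R : realType} {p : nat -> nat -> R -> R} {q : nat -> nat -> R} {M : R}.
Hypotheses (p_tf : transition_function p) (p_q : has_q_matrix p q).
Hypothesis q_le : forall i, - q i i <= M.
Context (lambda : R).
Hypothesis lambda_gt0 : 0 < lambda.
Notation mu := (@lebesgue_measure R).

(** Values at negative times are arbitrary; the even extension is continuous on the
   whole line and has the same Laplace transform. *)
Let p_even i j (t : R) : R := p i j `|t|.

Let p_even_itv i j t : 0 <= p_even i j t <= 1.
Proof. by rewrite (tf_ge0 p_tf)//= (tf_le1_entry p_tf). Qed.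

Let discounted_ge0 i j t : 0 <= expR (- (lambda * t)) * p_even i j t.
Proof. by rewrite mulr_ge0 ?expR_ge0//; have /andP[] := p_even_itv i j t. Qed.

Let p_even_continuous i j : continuous (p_even i j).
Proof.
have M0 : 0 <= M.
  have := tf_exit_leM p_tf p_q q_le 0 (ler01 : 0 <= (1 : R)).
  by have := tf_le1_entry p_tf 0 0 (ler01 : 0 <= (1 : R)); lra.
move=> x; apply/cvgrPdist_le => e e0; near=> y.
apply: le_trans (tf_lipschitz p_tf p_q q_le i j (normr_ge0 x) (normr_ge0 y)) _.
apply: (@le_trans _ _ (M * `|x - y|)).
  by rewrite ler_wpM2l// ler_dist_dist.
apply: (@le_trans _ _ (M * (e / (M + 1)))).
  rewrite ler_wpM2l//; near: y.
  apply: cvgr_dist_le; [exact: cvg_id|by rewrite divr_gt0// ltr_wpDl].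
rewrite mulrCA ger_pMr// ler_pdivrMr ?ltr_wpDl//; lra.
Unshelve. all: by end_near. Qed.

Let laplace_even i j : laplace (p i j) lambda = laplace (p_even i j) lambda.
Proof.
apply: eq_Rintegral => t; rewrite inE/= in_itv/= andbT => t0.
by rewrite /p_even ger0_norm.
Qed.

Lemma resolvent_itv i j : 0 <= laplace (p i j) lambda <= lambda^-1.
Proof.
by rewrite laplace_even;
   exact: (laplace_itv lambda_gt0 (@p_even_continuous i j) (p_even_itv i j)).
Qed.

(** Chapman-Kolmogorov at times [s] and [t], integrated over [t]. *)
Lemma sums_resolvent_shift i j s : 0 <= s ->
  sums (fun k => p i k s * laplace (p k j) lambda)
       (laplace (fun t => p_even i j (s + t)) lambda).
Proof.
move=> s0; apply/sums_nneseries.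
  move=> k; have /andP[phi0 _] := resolvent_itv k j.
  by rewrite mulr_ge0 ?(tf_ge0 p_tf).
have cs : continuous (fun t => p_even i j (s + t)).
  move=> z; apply: (@continuous_comp _ _ _ (fun t => s + t) (p_even i j)).
    by apply: continuousD; [exact: cst_continuous|exact: cvg_id].
  exact: p_even_continuous.
have summand (t : R) : 0 <= t ->
    (\sum_(0 <= k <oo) ((p i k s)%:E * (expR (- (lambda * t)) * p_even k j t)%:E)
     = (expR (- (lambda * t)) * p_even i j (s + t))%:E)%E.
  move=> t0; apply/sums_nneseries.
    by move=> k; rewrite mulr_ge0 ?(tf_ge0 p_tf)// discounted_ge0.
  have st0 : 0 <= s + t by rewrite addr_ge0.
  rewrite /p_even (ger0_norm st0) (ger0_norm t0).
  have := sumsZ (expR (- (lambda * t))) (tf_sums_CK p_tf (i := i) (j := j) s0 t0).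
  apply: eq_sums => k.
  by rewrite mulrCA.
rewrite -laplace_integral//.
under eq_eseriesr => k _ do rewrite laplace_even EFinM -laplace_integral//.
have m (k : nat) : measurable_fun (`[(0 : R), +oo[ : set R)
    (fun t : R => expR (- (lambda * t)) * p_even k j t).
  by apply: discounted_measurable.
under eq_eseriesr => k _.
  rewrite -ge0_integralZl//; last 3 first.
  - by apply/measurable_EFinP; exact: m.
  - by move=> t _; rewrite lee_fin discounted_ge0.
  - by rewrite lee_fin (tf_ge0 p_tf).
  over.
rewrite -integral_nneseries//; last 2 first.
- move=> k; by apply: measurable_funeM; apply/measurable_EFinP; exact: m.
- by move=> k t _; rewrite -EFinM lee_fin mulr_ge0 ?(tf_ge0 p_tf)// discounted_ge0.
apply: eq_integral => t; rewrite inE/= in_itv/= andbT.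
exact: summand.
Qed.

(** The resolvent equation (lambda I - Q) Phi = I, in shifted form.  The semigroup
   acts on column [j] of Phi by shifting the integrand
   ([sums_resolvent_shift]), so the derivative at 0 comes from
   [laplace_shift_derivative]. *)
Lemma resolvent_backward i j : sums (q i) 0 ->
  sums (fun k => uniformized M q i k * laplace (p k j) lambda)
    ((lambda + M) * laplace (p i j) lambda - (i == j)%:R).
Proof.
move=> qi0.
have := backward_uniformized p_tf p_q q_le qi0 (resolvent_itv^~ j)
  (fun t t0 => sums_resolvent_shift (i := i) (j := j) (ltW t0)).
move=> /(_ (lambda * laplace (p i j) lambda - (i == j)%:R)).
rewrite addrAC mulrDl; apply.
have -> : (i == j)%:R = p_even i j 0 by rewrite /p_even normr0 (tf_id p_tf).
rewrite laplace_even.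
have := laplace_shift_derivative (lambda := lambda) (p_even_continuous (i:=i) (j:=j)).
apply: cvg_trans; apply: near_eq_cvg; near=> t.
by rewrite laplace_shift//; exact: p_even_continuous.
Unshelve. all: by end_near. Qed.

End Resolvent.

(** * The q-matrices of the queue *)

Lemma series_from1 (R : realType) (f : nat -> R) :
  (fun n => \sum_(1 <= j < n) f j) = series (fun j => (j != 0%N)%:R * f j).
Proof.
apply/funext => -[|n]; first by rewrite seriesEnat /= !big_geq.
rewrite seriesEnat /= [RHS]big_ltn// mul0r add0r.
by apply: eq_big_nat => j /andP[j0 _]; rewrite -lt0n j0 mul1r.
Qed.

Section QMatrices.
Context {R : realType} {c : nat} {b h : nat -> R} {beta : R}.
Hypothesis b_ge0 : forall j : nat, j != 1%N -> 0 <= b j.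
Hypothesis b_sum : (\sum_(0 <= j <oo | j != 1%N) (b j)%:E = (- b 1%N)%:E)%E.
Hypothesis beta_gt0 : 0 < beta.
Hypothesis h_ge0 : forall j, (1 <= j)%N -> 0 <= h j.
Hypothesis h_fin : (\sum_(1 <= j <oo) (h j)%:E < +oo)%E.

(** [b] and [h] with their negative, respectively arbitrary, entry replaced by 0, so
   that results on nonnegative coefficients apply. *)
Definition offdiag (R : realType) (b : nat -> R) (k : nat) : R :=
  (k != 1%N)%:R * b k.

Definition from1 (R : realType) (h : nat -> R) (k : nat) : R :=
  (k != 0%N)%:R * h k.

Lemma offdiag_ge0 k : 0 <= offdiag b k.
Proof.
by rewrite /offdiag; case: eqP => [_|/eqP k1]; rewrite ?mul0r// mul1r b_ge0.
Qed.

Lemma sums_offdiag : sums (offdiag b) (- b 1%N).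
Proof.
apply/sums_nneseries; first exact: offdiag_ge0.
rewrite -b_sum [RHS]eseries_mkcond; apply: eq_eseriesr => k _.
by rewrite /offdiag; case: ifP => _; rewrite ?mul1r ?mul0r.
Qed.

Lemma offdiag_decomp k : b k = offdiag b k + (k == 1%N)%:R * b 1%N.
Proof.
by rewrite /offdiag; case: eqP => [->|_]; rewrite ?mul1r !mul0r ?add0r ?addr0.
Qed.

Lemma sums_b : sums b 0.
Proof.
have := sumsD sums_offdiag (sums_delta 1 (b 1%N)); rewrite addNr.
by apply: eq_sums => k; rewrite [RHS]offdiag_decomp.
Qed.

Lemma sums_weighted (a : nat -> R) l s : (forall k, 0 <= a k) -> sums a l ->
  0 <= s <= 1 -> exists2 m, sums (fun k => a k * s ^+ k) m & m <= l.
Proof.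
move=> a0 al /andP[s0 s1]; apply: sums_dominated al => k.
by rewrite mulr_ge0 ?exprn_ge0//= ler_piMr// exprn_ile1.
Qed.

Lemma sums_offdiag_gf s : 0 <= s <= 1 ->
  sums (fun k => offdiag b k * s ^+ k) (Bgf b s - b 1%N * s).
Proof.
move=> s01; have [l al _] := sums_weighted offdiag_ge0 sums_offdiag s01.
have : sums (fun k => b k * s ^+ k) (l + b 1%N * s).
  apply: eq_sums (sumsD al (sums_delta 1 (b 1%N * s))) => k.
  rewrite [b k]offdiag_decomp mulrDl; congr +%R.
  by case: eqP => [->|]; rewrite ?mul1r ?mul0r.
by move=> /sums_lim; rewrite /Bgf => ->; rewrite addrK.
Qed.

Lemma sums_Bgf s : 0 <= s <= 1 -> sums (fun k => b k * s ^+ k) (Bgf b s).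
Proof.
move=> s01; have := sumsD (sums_offdiag_gf s01) (sums_delta 1 (b 1%N * s)).
rewrite subrK; apply: eq_sums => k; rewrite [b k]offdiag_decomp mulrDl; congr +%R.
by case: eqP => [->|]; rewrite ?mul1r ?mul0r.
Qed.

Lemma Bgf1 : Bgf b 1 = 0.
Proof.
apply: sums_unique sums_b; have := sums_Bgf (s := 1); rewrite ler01 lexx => /(_ isT).
by apply: eq_sums => k; rewrite expr1n mulr1.
Qed.

Lemma from1_ge0 k : 0 <= from1 h k.
Proof.
by rewrite /from1; case: eqP => [_|/eqP k1]; rewrite ?mul0r// mul1r h_ge0// lt0n.
Qed.

Definition htot (R : realType) (h : nat -> R) : R :=
  limn (fun n => \sum_(1 <= j < n) h j).

Lemma sums_h : sums (from1 h) (htot h).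
Proof.
rewrite /htot series_from1.
have h1 n : (\sum_(0 <= k < n) from1 h k)%:E = (\sum_(1 <= k < n) (h k)%:E)%E.
  by rewrite sumEFin; congr EFin; rewrite -[RHS]/((fun n => \sum_(1 <= k < n) h k) n)
     series_from1 seriesEnat.
suff [l hl _] : exists2 l, sums (from1 h) l &
    l <= fine (\sum_(1 <= j <oo) (h j)%:E) by rewrite (sums_lim hl).
apply: sums_bounded; first exact: from1_ge0.
have s0 : (0 <= \sum_(1 <= j <oo) (h j)%:E)%E.
  by apply: nneseries_ge0 => k k1 _; rewrite lee_fin h_ge0.
move=> n; rewrite -lee_fin h1 fineK ?ge0_fin_numE//.
by apply: nneseries_lim_ge => k k1 _; rewrite lee_fin h_ge0.
Qed.

Lemma sums_Hgf s : 0 <= s <= 1 -> sums (fun k => from1 h k * s ^+ k) (Hgf h s).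
Proof.
move=> s01; have [l hl _] := sums_weighted from1_ge0 sums_h s01.
rewrite /Hgf series_from1.
have E : (fun j => (j != 0%N)%:R * (h j * s ^+ j)) = (fun k => from1 h k * s ^+ k).
  by apply/funext => k; rewrite mulrA.
by rewrite E (sums_lim hl).
Qed.

Lemma Hgf1 : Hgf h 1 = htot h.
Proof.
apply: sums_unique sums_h; have := sums_Hgf (s := 1); rewrite ler01 lexx => /(_ isT).
by apply: eq_sums => k; rewrite expr1n mulr1.
Qed.

Lemma htot_ge0 : 0 <= htot h.
Proof. exact: sums_ge0 from1_ge0 sums_h. Qed.

(** A row of Q* is the shifted sequence [b], as for a single server, plus a
   correction for the additional busy servers. *)
Lemma qstarS i j : qstar c b i.+1 j =
  (if (j < i)%N then 0 else b (j - i)%N)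
  + ((minn i.+1 c)%:R - 1) * b 0%N * ((j == i)%:R - (j == i.+1)%:R).
Proof.
rewrite /qstar /=; case: (ltngtP j i) => [ji|ij|->].
- have ji1 : (j < i.+1)%N by exact: ltnW.
  by rewrite (ltn_eqF ji1) ltnNge (ltnW ji1)/= subrr mulr0 addr0.
- case: (ltngtP j i.+1) => [|ij'|->]; first by rewrite ltnS leqNgt ij.
    by rewrite subrr mulr0 addr0; congr b; lia.
  by rewrite subSnn /=; ring.
- by rewrite subnn ltn_eqF//=; ring.
Qed.

Lemma sums_qstarS i s : 0 <= s <= 1 ->
  sums (fun j => qstar c b i.+1 j * s ^+ j)
    (s ^+ i * (Bgf b s + ((minn i.+1 c)%:R - 1) * b 0%N * (1 - s))).
Proof.
move=> s01; set k := ((minn i.+1 c)%:R - 1) * b 0%N.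
have S1 : sums (fun j => (if (j < i)%N then 0 else b (j - i)%N) * s ^+ j)
    (s ^+ i * Bgf b s).
  rewrite -[s ^+ i * _]add0r.
  rewrite -[X in sums _ (X + _)](_ : \sum_(0 <= j < i)
      (if (j < i)%N then 0 else b (j - i)%N) * s ^+ j = 0); last first.
    by rewrite big_nat_cond big1// => j /andP[/andP[_ ->]]; rewrite mul0r.
  apply: sums_shift; apply: eq_sums (sumsZ (s ^+ i) (sums_Bgf s01)) => j.
  by rewrite ltnNge leq_addl/= addnK exprD; ring.
have S2 := sumsB (sums_delta i (k * s ^+ i)) (sums_delta i.+1 (k * s ^+ i.+1)).
have := sumsD S1 S2.
rewrite (_ : _ + (_ - _) = s ^+ i * (Bgf b s + k * (1 - s))); last first.
  by rewrite exprS; ring.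
apply: eq_sums => j; rewrite qstarS -/k [RHS]mulrDl; congr +%R.
rewrite mulrBr mulrBl; congr (_ - _); rewrite mulrCA -!mulrA.
  by case: eqP => [->|]; rewrite ?mul0r ?mulr0// !mul1r.
by case: eqP => [->|]; rewrite ?mul0r ?mulr0// !mul1r.
Qed.

Lemma sums_qstar0 i : sums (qstar c b i) 0.
Proof.
case: i => [|i].
  have := @sums_finite R 0 (qstar c b 0); rewrite big_geq//; apply=> k _.
  by rewrite /qstar.
have := sums_qstarS (i := i) (s := 1); rewrite ler01 lexx => /(_ isT).
rewrite Bgf1 subrr mulr0 addr0 mulr0.
by apply: eq_sums => j; rewrite expr1n mulr1.
Qed.

Lemma qmatrixS i j : qmatrix c b h beta i.+1 j =
  qstar c b i.+1 j + beta * ((j == 0%N)%:R - (j == i.+1)%:R).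
Proof.
rewrite /qmatrix /qs /qd /= addr0; congr +%R.
case: (eqVneq j 0%N) => [->|j0]; first by rewrite subr0 mulr1.
by case: eqP => _; rewrite sub0r ?mulrN1 ?oppr0 ?mulr0.
Qed.

Lemma qmatrix0 j : qmatrix c b h beta 0 j = from1 h j - (j == 0%N)%:R * htot h.
Proof.
rewrite /qmatrix /qstar /qs /qd /= add0r addr0 /from1.
by case: eqP => _; rewrite !(mul0r, mul1r) ?add0r ?subr0.
Qed.

Definition qmatrix_gf (i : nat) (s : R) : R :=
  if i is i'.+1 then
    s ^+ i' * (Bgf b s + ((minn i c)%:R - 1) * b 0%N * (1 - s))
    + beta * (1 - s ^+ i)
  else Hgf h s - htot h.

Lemma sums_qmatrix i s : 0 <= s <= 1 ->
  sums (fun j => qmatrix c b h beta i j * s ^+ j) (qmatrix_gf i s).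
Proof.
move=> s01; case: i => [|i] /=.
  have := sumsB (sums_Hgf s01) (sums_delta 0 (htot h)).
  apply: eq_sums => j; rewrite qmatrix0 mulrBl; congr (_ - _).
  by case: eqP => [->|_]; rewrite ?mul0r// expr0 mulr1.
have := sumsD (sums_qstarS (i := i) s01) (sumsZ beta
  (sumsB (sums_delta 0 1) (sums_delta i.+1 (s ^+ i.+1)))).
apply: eq_sums => j; rewrite qmatrixS [RHS]mulrDl; congr +%R; rewrite -mulrA; congr *%R.
rewrite mulrBl; congr (_ - _).
  by case: eqP => [->|_]; rewrite ?mul0r// expr0.
by case: eqP => [->|_]; rewrite ?mul0r.
Qed.

Definition rate_bound : R := - b 1%N + c%:R * b 0%N + htot h + beta.

Lemma qstar_diag i : - qstar c b i i <= rate_bound.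
Proof.
have b0 : 0 <= b 0%N by exact: b_ge0.
have b1 : 0 <= - b 1%N by exact: sums_ge0 offdiag_ge0 sums_offdiag.
have h0 := htot_ge0.
have cb : 0 <= c%:R * b 0%N by rewrite mulr_ge0.
rewrite /rate_bound; case: i => [|i].
  by rewrite /qstar /= oppr0; have := ltW beta_gt0; lra.
rewrite qstarS ltnNge leqnSn /= subSnn eqxx gtn_eqF//.
have : (minn i.+1 c)%:R * b 0%N <= c%:R * b 0%N.
  by rewrite ler_wpM2r// ler_nat geq_minr.
rewrite sub0r mulrN1 mulrBl mul1r opprD opprK; have := ltW beta_gt0; lra.
Qed.

Lemma qmatrix_diag i : - qmatrix c b h beta i i <= rate_bound.
Proof.
have b0 : 0 <= b 0%N by exact: b_ge0.
have b1 : 0 <= - b 1%N by exact: sums_ge0 offdiag_ge0 sums_offdiag.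
have h0 := htot_ge0.
have cb : 0 <= c%:R * b 0%N by rewrite mulr_ge0.
rewrite /rate_bound; case: i => [|i].
  by rewrite qmatrix0 /from1 /= mul0r mul1r sub0r opprK; have := ltW beta_gt0; lra.
rewrite qmatrixS qstarS ltnNge leqnSn /= subSnn eqxx gtn_eqF//.
have : (minn i.+1 c)%:R * b 0%N <= c%:R * b 0%N.
  by rewrite ler_wpM2r// ler_nat geq_minr.
rewrite !sub0r !mulrN1 mulrBl mul1r !opprD !opprK; have := ltW beta_gt0; lra.
Qed.

(** * The equilibrium distribution *)

Context {p pstar : nat -> nat -> R -> R} (pi : nat -> R).
Hypothesis p_tf : transition_function p.
Hypothesis p_q : has_q_matrix p (qmatrix c b h beta).
Hypothesis pi_eq : equilibrium_distribution p pi.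
Hypothesis pstar_tf : transition_function pstar.
Hypothesis pstar_q : has_q_matrix pstar (qstar c b).

Let M := rate_bound.
Let r := uniformized M (qmatrix c b h beta).
Let rstar := uniformized M (qstar c b).

Let r_ge0 i j : 0 <= r i j.
Proof. exact: (uniformized_ge0 p_tf p_q qmatrix_diag). Qed.

Let rstar_ge0 i j : 0 <= rstar i j.
Proof. exact: (uniformized_ge0 pstar_tf pstar_q qstar_diag). Qed.

Lemma pi_ge0 k : 0 <= pi k. Proof. exact: (eqd_ge0 pi_eq). Qed.

Lemma sums_pi : sums pi 1.
Proof. by apply/sums_nneseries; [exact: pi_ge0|exact: eqd_sum1 pi_eq]. Qed.

Lemma stationary j : sums (fun i => pi i * r i j) (M * pi j).
Proof. exact: (equilibrium_uniformized p_tf p_q qmatrix_diag). Qed.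

Definition pgf (R : realType) (pi : nat -> R) (s : R) : R :=
  limn (series (fun k => pi k * s ^+ k)).

Lemma sums_pgf s : 0 <= s <= 1 -> sums (fun k => pi k * s ^+ k) (pgf pi s).
Proof.
move=> s01; have [l pl _] := sums_weighted pi_ge0 sums_pi s01.
by rewrite /pgf (sums_lim pl).
Qed.

(** The powers of [s] combine the equations of pi Q = 0 into one, and the two sums
   are exchanged; working with Q + M I keeps all terms nonnegative. *)
Lemma sums_pi_qmatrix_gf s : 0 <= s <= 1 ->
  sums (fun i => pi i * qmatrix_gf i s) 0.
Proof.
move=> s01; have /andP[s0 s1] := s01.
have rgf i : sums (fun j => r i j * s ^+ j) (qmatrix_gf i s + M * s ^+ i).
  apply: eq_sums (sumsD (sums_qmatrix (i := i) s01) (sums_delta i (M * s ^+ i))) => j.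
  rewrite /r /uniformized [RHS]mulrDl; congr +%R; rewrite [i == j]eq_sym.
  by case: eqP => [->|_]; rewrite ?mulr1 ?mulr0 ?mul0r ?mul1r.
have := @sums_interchange R (fun j i => s ^+ j * (pi i * r i j))
  (fun j => s ^+ j * (M * pi j)) (fun i => pi i * (qmatrix_gf i s + M * s ^+ i))
  (M * pgf pi s).
move=> H; have {H} S : sums (fun i => pi i * (qmatrix_gf i s + M * s ^+ i)) (M * pgf pi s).
  apply: H.
  - by move=> j i; rewrite !mulr_ge0// ?exprn_ge0 ?pi_ge0.
  - by move=> j; apply: sumsZ; exact: stationary.
  - move=> i; apply: eq_sums (sumsZ (pi i) (rgf i)) => j; by ring.
  - by apply: eq_sums (sumsZ M (sums_pgf s01)) => j; ring.
have := sumsB S (sumsZ M (sums_pgf s01)); rewrite subrr.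
by apply: eq_sums => i; ring.
Qed.

(** For [i >= c] the generating function of row [i] of Q, multiplied by [s], is
   [(Bc c b s - beta * s) * s ^+ i + beta * s].  Subtracting this expression from all
   rows leaves a series with finitely many nonzero terms, namely the contribution
   of state 0 and the correction for idle servers. *)
Lemma pgf_identity s : 0 <= s <= 1 ->
  (Bc c b s - beta * s) * (1 - pgf pi s) =
  (1 - pi 0%N) * Bc c b s - s * pi 0%N * (htot h - Hgf h s)
  - (1 - s) * \sum_(1 <= k < c) pi k * s ^+ k * (c%:R - k%:R) * b 0%N.
Proof.
move=> s01.
(* [f i] is the deviation of row [i] from the expression valid for [i >= c]. *)
pose f i := s * (pi i * qmatrix_gf i s)
  - ((Bc c b s - beta * s) * (pi i * s ^+ i) + beta * s * pi i).
have f0 : f 0%N = s * pi 0%N * (Hgf h s - htot h) - Bc c b s * pi 0%N.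
  by rewrite /f /= expr0; ring.
have fS i : (0 < i)%N -> f i = - ((1 - s) *
    (pi i * s ^+ i * (c%:R - (minn i c)%:R) * b 0%N)).
  by case: i => // i _; rewrite /f /= /Bc exprS; ring.
have S1 := sumsB (sumsZ s (sums_pi_qmatrix_gf s01))
  (sumsD (sumsZ (Bc c b s - beta * s) (sums_pgf s01)) (sumsZ (beta * s) sums_pi)).
have S2 : sums f (\sum_(0 <= k < c.+1) f k).
  apply: sums_finite => k ck.
  rewrite fS ?(leq_ltn_trans _ ck)// (minn_idPr (ltnW ck)) subrr.
  by rewrite mulr0 mul0r mulr0 oppr0.
have := sums_unique S1 S2; rewrite big_nat_recl//= f0.
rewrite -(big_add1 _ _ 0 c.+1 xpredT f).
have -> : \sum_(1 <= i < c.+1) f i =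
    - ((1 - s) * \sum_(1 <= k < c) pi k * s ^+ k * (c%:R - k%:R) * b 0%N).
  case: (posnP c) => [->|c0]; first by rewrite !big_geq// mulr0 oppr0.
  rewrite big_nat_recr//= fS// minnn subrr mulr0 mul0r mulr0 oppr0 addr0.
  rewrite mulr_sumr -sumrN; apply: eq_big_nat => k /andP[k0 kc].
  by rewrite fS// (minn_idPl (ltnW kc)).
by move=> H; lra.
Qed.

Let phi j k := laplace (pstar k j) beta.

Let phi_itv j k : 0 <= phi j k <= beta^-1.
Proof. exact: (resolvent_itv pstar_tf pstar_q qstar_diag). Qed.

(** State 0 is absorbing for Q*. *)
Let phi0 j : (0 < j)%N -> phi j 0%N = 0.
Proof.
move=> j0; rewrite /phi /laplace.
rewrite (_ : \int[_]_(_ in _) _ = \int[lebesgue_measure]_(t in `[(0 : R), +oo[) 0).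
  by rewrite /Rintegral integral0.
apply: eq_Rintegral => t; rewrite inE/= in_itv/= andbT => t0.
have p00 := tf_exit_le pstar_tf pstar_q 0%N t0.
have p0j := tf_two_le1 pstar_tf (i := 0%N) (j := j) t0.
have := p0j; rewrite eq_sym -lt0n => /(_ j0) {}p0j.
suff -> : pstar 0%N j t = 0 by rewrite mulr0.
apply/eqP; rewrite eq_le (tf_ge0 pstar_tf)// andbT.
move: p00; rewrite /qstar /= oppr0 mul0r; lra.
Qed.

(** Restricted to the states [k >= 1], pi Q = 0 reads pi (beta I - Q* ) = pi_0 h;
   multiplying by column [j] of the resolvent Phi of Q* gives pi_j = pi_0 (h Phi)_j.
   Column 0 of Q* needs no equation since [phi j 0 = 0]. *)
Lemma pi_resolvent j : (0 < j)%N -> pi j = pi 0%N * Lsum h pstar j beta.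
Proof.
move=> j0.
have phij_ge0 k : 0 <= phi j k by have /andP[] := phi_itv j k.
have dom (a : nat -> R) l : (forall k, 0 <= a k) -> sums a l ->
    exists2 m, sums (fun k => a k * phi j k) m & m <= l * beta^-1.
  move=> a0 al; have := sumsZ beta^-1 al; rewrite mulrC; apply: sums_dominated => k.
  by rewrite mulr_ge0//= mulrC ler_wpM2r//; have /andP[] := phi_itv j k.
have [S piS _] := dom _ _ pi_ge0 sums_pi.
have [L hL _] := dom _ _ from1_ge0 sums_h.
have -> : Lsum h pstar j beta = L.
  rewrite /Lsum series_from1 -(sums_lim hL); congr (limn (series _)).
  by apply/funext => k; rewrite mulrA.
(* The product of pi, Q* + M I and Phi is computed by rows, using
   [resolvent_backward], and by columns, using [stationary]. *)
have row i : sums (fun k => from1 pi i * rstar i k * phi j k)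
    (from1 pi i * ((beta + M) * phi j i - (i == j)%:R)).
  have := resolvent_backward pstar_tf pstar_q qstar_diag beta_gt0 (j := j) (sums_qstar0 i).
  move=> /(sumsZ (from1 pi i)); apply: eq_sums => k; exact: mulrA.
have col k : sums (fun i => from1 pi i * rstar i k * phi j k)
    (((M + beta) * pi k - pi 0%N * from1 h k) * phi j k).
  have [->|k0] := eqVneq k 0%N.
    rewrite phi0// mulr0; have := @sums_finite R 0 (fun i => from1 pi i * rstar i 0 * 0).
    by rewrite big_geq//; apply=> i _; rewrite mulr0.
  have H := sumsB (sumsD (stationary (j := k)) (sums_delta k (beta * pi k)))
    (sums_delta 0 (pi 0%N * from1 h k)).
  rewrite [X in sums _ X]mulrC (mulrDl M); apply: eq_sums (sumsZ (phi j k) H) => i.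
  rewrite mulrC; congr *%R; rewrite /r /rstar /uniformized /from1.
  case: i => [|i] /=.
    rewrite qmatrix0 /from1 [0%N == k]eq_sym (negbTE k0) /=.
    ring.
  rewrite qmatrixS (negbTE k0) mul1r [k == _]eq_sym.
  by case: eqP => [->|_] /=; ring.
have A0 i k : 0 <= from1 pi i * rstar i k * phi j k.
  by rewrite /from1 !mulr_ge0 ?pi_ge0 ?rstar_ge0 ?phij_ge0 ?ler0n.
have rows : sums (fun i => from1 pi i * ((beta + M) * phi j i - (i == j)%:R))
    ((beta + M) * S - pi j).
  apply: eq_sums (sumsB (sumsZ (beta + M) piS) (sums_delta j (pi j))) => i.
  rewrite /from1; have [->|ij] := eqVneq i j; first by rewrite -lt0n j0 /=; ring.
  by case: eqP => [->|_]; rewrite ?phi0//=; ring.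
have cols := sums_interchange A0 row col rows.
have cols' : sums (fun k => ((M + beta) * pi k - pi 0%N * from1 h k) * phi j k)
    ((M + beta) * S - pi 0%N * L).
  apply: eq_sums (sumsB (sumsZ (M + beta) piS) (sumsZ (pi 0%N) hL)) => k.
  by rewrite mulrBl !mulrA.
by have := sums_unique cols cols'; lra.
Qed.

(** * The mean queue sizes *)

(** [pgf_identity] at a zero of [Ufun], divided by [u]. *)
Lemma pi0_identity u : 0 < u <= 1 -> Ufun c b beta u = 0 ->
  pi 0%N * (beta + htot h - Hgf h u)
  + \sum_(1 <= k < c) pi k * u ^+ k.-1 * (c%:R - k%:R) * b 0%N * (1 - u) = beta.
Proof.
move=> /andP[u0 u1] Uu; have Bu : Bc c b u = beta * u.
  by move: Uu; rewrite /Ufun => /subr0_eq.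
have := @pgf_identity u; rewrite (ltW u0) u1 => /(_ isT).
rewrite Bu subrr mul0r => /eqP; rewrite eq_sym => /eqP id.
have S : (1 - u) * \sum_(1 <= k < c) pi k * u ^+ k * (c%:R - k%:R) * b 0%N
    = u * \sum_(1 <= k < c) pi k * u ^+ k.-1 * (c%:R - k%:R) * b 0%N * (1 - u).
  rewrite !mulr_sumr; apply: eq_big_nat => k /andP[k0 _].
  have -> : u ^+ k = u * u ^+ k.-1 by rewrite -exprS prednK.
  by ring.
apply: (mulfI (lt0r_neq0 u0)); rewrite S in id; lra.
Qed.

(** If [pi 0 = 0] then [pi_resolvent] makes all other probabilities in
   [pi0_identity] vanish too.  Positivity makes an infinite mu_1 force an infinite
   mean. *)
Lemma pi0_gt0 u : 0 < u <= 1 -> Ufun c b beta u = 0 -> 0 < pi 0%N.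
Proof.
move=> u01 Uu; rewrite lt_neqAle pi_ge0 andbT; apply/negP => /eqP w0.
have := pi0_identity u01 Uu; rewrite -w0 mul0r add0r => id.
have := beta_gt0; rewrite -id big_nat_cond big1 ?ltxx// => k /andP[/andP[k0 _] _].
by rewrite pi_resolvent// -w0 !mul0r.
Qed.

(** Mass 1 at state 0 would force all immigration rates [h j] to vanish.  The strict
   bound makes an infinite derivative of [Bc] force an infinite mean. *)
Lemma pi0_lt1 : (0 < \sum_(1 <= j <oo) (h j)%:E)%E -> pi 0%N < 1.
Proof.
move=> h_gt0; have le1 : pi 0%N <= 1.
  by have := sums_ge_partial 1 pi_ge0 sums_pi; rewrite big_nat1.
rewrite lt_neqAle le1 andbT; apply/negP => /eqP w1.
have wS k : (0 < k)%N -> pi k = 0.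
  move=> k0; have := sums_ge_partial k.+1 pi_ge0 sums_pi.
  rewrite big_nat_recl//= w1 gerDl => s0; apply/eqP; rewrite eq_le pi_ge0 andbT.
  apply: le_trans s0; case: k k0 => // k _.
  by rewrite big_nat_recr//= lerDr sumr_ge0// => i _; exact: pi_ge0.
move: h_gt0; suff -> : (\sum_(1 <= j <oo) (h j)%:E = 0)%E by rewrite ltxx.
apply: eseries0 => j j0 _; congr EFin.
have := stationary (j := j); rewrite (wS _ j0) mulr0 => S.
have S' : sums (fun i => (i == 0%N)%:R * (pi 0%N * r 0 j)) (pi 0%N * r 0 j) by exact: sums_delta.
have : pi 0%N * r 0 j = 0.
  apply: (sums_unique S'); apply: eq_sums S => i.
  by case: eqP => [->|/eqP i0]; rewrite ?mul1r// mul0r wS ?mul0r// lt0n.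
rewrite w1 mul1r /r /uniformized qmatrix0 /from1 [0%N == j]eq_sym.
by rewrite -(negbK (j == 0%N)) -lt0n j0 /= !mul0r mul1r mulr0 subr0 addr0.
Qed.

Lemma mean_quotient_cvg :
  ((1 - pgf pi s) / (1 - s))%:E @[s --> 1^'-] --> (\sum_(0 <= k <oo) (k%:R * pi k)%:E)%E.
Proof. by apply: left_quotient_cvg; [exact: pi_ge0|exact: sums_pi|exact: sums_pgf]. Qed.

Lemma left_derive1_lim (f : R -> R) (l : \bar R) :
  ((f s - f 1) / (s - 1))%:E @[s --> 1^'-] --> l -> left_derive1 f = l.
Proof. by move=> /cvg_lim; apply. Qed.

Lemma Hgf_quotient_cvg :
  ((Hgf h s - Hgf h 1) / (s - 1))%:E @[s --> 1^'-] --> left_derive1 (Hgf h).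
Proof.
have C : ((Hgf h s - Hgf h 1) / (s - 1))%:E @[s --> 1^'-] -->
    (\sum_(0 <= k <oo) (k%:R * from1 h k)%:E)%E.
  have := left_quotient_cvg from1_ge0 sums_h sums_Hgf.
  rewrite -Hgf1; apply: cvg_trans; apply: near_eq_cvg; apply: nearW => s.
  by rewrite -[Hgf h 1 - _]opprB -[1 - s]opprB invrN mulrNN.
by rewrite (left_derive1_lim C).
Qed.

Lemma Hgf_quotient_ge0 s : 0 <= s < 1 -> 0 <= (Hgf h s - Hgf h 1) / (s - 1).
Proof.
move=> /andP[s0 s1]; have s01 : 0 <= s <= 1 by rewrite s0 ltW.
rewrite mulr_le0// ?invr_le0 subr_le0 ?(ltW s1)// Hgf1.
have [l hl] := sums_weighted from1_ge0 sums_h s01.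
by rewrite (sums_unique hl (sums_Hgf s01)).
Qed.

Lemma Bc1 : Bc c b 1 = 0.
Proof. by rewrite /Bc Bgf1 subrr mulr0 addr0. Qed.

(** The linear part of [Bc] contributes this constant to its difference quotient;
   what remains has nonnegative coefficients. *)
Let kappa := b 1%N - (c%:R - 1) * b 0%N.

Lemma Bc_quotientE s : s != 1 -> (Bc c b s - Bc c b 1) / (s - 1) =
  (- b 1%N - (Bgf b s - b 1%N * s)) / (1 - s) + kappa.
Proof.
move=> s1; rewrite Bc1 subr0 /Bc /kappa.
by field; rewrite !subr_eq0 s1 eq_sym s1.
Qed.

Lemma Bc_quotient_ge s : 0 <= s < 1 -> kappa <= (Bc c b s - Bc c b 1) / (s - 1).
Proof.
move=> /andP[s0 s1]; have s01 : 0 <= s <= 1 by rewrite s0 ltW.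
rewrite Bc_quotientE ?lt_eqF// lerDr divr_ge0 ?subr_ge0 ?(ltW s1)//.
have [l bl] := sums_weighted offdiag_ge0 sums_offdiag s01.
by rewrite (sums_unique bl (sums_offdiag_gf s01)).
Qed.

Lemma Bc_quotient_cvg :
  ((Bc c b s - Bc c b 1) / (s - 1))%:E @[s --> 1^'-] --> left_derive1 (Bc c b).
Proof.
have C : ((Bc c b s - Bc c b 1) / (s - 1))%:E @[s --> 1^'-] -->
    (\sum_(0 <= k <oo) (k%:R * offdiag b k)%:E + kappa%:E)%E.
  have L0 : (0 <= \sum_(0 <= k <oo) (k%:R * offdiag b k)%:E)%E.
    by apply: nneseries_ge0 => k _ _; rewrite lee_fin mulr_ge0// offdiag_ge0.
  have := left_quotient_cvg offdiag_ge0 sums_offdiag sums_offdiag_gf.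
  have K : kappa%:E @[s --> (1 : R)^'-] --> kappa%:E by exact: cvg_cst.
  move=> H; apply: cvg_trans (cvgeD (fin_num_adde_defl _ _) H K) => //.
  apply: near_eq_cvg; apply: filterS (nbhs_left_neq 1) => s s1.
  by rewrite /= -EFinD Bc_quotientE.
by rewrite (left_derive1_lim C).
Qed.

Lemma left_derive1_Hgf_ge0 : (0 <= left_derive1 (Hgf h))%E.
Proof.
apply: (cvge_to_ge Hgf_quotient_cvg); near=> s; rewrite lee_fin Hgf_quotient_ge0//.
by apply/andP; split; near: s; [exact: nbhs_left_ge|exact: nbhs_left_lt].
Unshelve. all: by end_near. Qed.

Lemma left_derive1_Bc_ge : (kappa%:E <= left_derive1 (Bc c b))%E.
Proof.
apply: (cvge_to_ge Bc_quotient_cvg); near=> s; rewrite lee_fin Bc_quotient_ge//.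
by apply/andP; split; near: s; [exact: nbhs_left_ge|exact: nbhs_left_lt].
Unshelve. all: by end_near. Qed.

(** [pgf_identity] divided by [- (1 - s)]. *)
Lemma mean_balance s : 0 <= s < 1 ->
  (beta * s - Bc c b s) * ((1 - pgf pi s) / (1 - s)) =
  (1 - pi 0%N) * ((Bc c b s - Bc c b 1) / (s - 1))
  + s * pi 0%N * ((Hgf h s - Hgf h 1) / (s - 1))
  + \sum_(1 <= k < c) pi k * s ^+ k * (c%:R - k%:R) * b 0%N.
Proof.
move=> /andP[s0 s1]; have s01 : 0 <= s <= 1 by rewrite s0 ltW.
have := pgf_identity s01; rewrite Bc1 subr0 Hgf1.
set A := \sum_(1 <= k < c) _ => id.
have s1' : 1 - s != 0 by rewrite subr_eq0 gt_eqF.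
have s1'' : s - 1 != 0 by rewrite subr_eq0 lt_eqF.
apply: (mulfI s1'); rewrite mulrCA [(1 - s) * (_ / _)]mulrC divfK//.
have -> : (beta * s - Bc c b s) * (1 - pgf pi s) =
  - ((1 - pi 0%N) * Bc c b s - s * pi 0%N * (htot h - Hgf h s) - (1 - s) * A).
  by rewrite -id; ring.
by field.
Qed.

Let A1 := \sum_(1 <= k < c) pi k * (c%:R - k%:R) * b 0%N.

(** The limit of [mean_balance] as [s] increases to 1.  If both derivatives are
   finite, then [Bc] tends to 0 and the factor on the left tends to [beta].
   Otherwise the right-hand side tends to infinity while that factor stays
   bounded above. *)
Lemma mean_formula u : (0 < \sum_(1 <= j <oo) (h j)%:E)%E ->
  0 < u <= 1 -> Ufun c b beta u = 0 ->
  (\sum_(0 <= k <oo) (k%:R * pi k)%:E =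
   if (left_derive1 (Hgf h) == +oo) || (left_derive1 (Bc c b) == +oo) then +oo
   else (((1 - pi 0%N) * fine (left_derive1 (Bc c b)) + A1
     + pi 0%N * fine (left_derive1 (Hgf h))) / beta)%:E)%E.
Proof.
move=> h_gt0 u01 Uu; have w0 := pi0_gt0 u01 Uu; have w1 := pi0_lt1 h_gt0.
have b0 : 0 <= b 0%N by exact: b_ge0.
have near01 : \forall s \near (1 : R)^'-, 0 <= s < 1.
  by near=> s; apply/andP; split; near: s; [exact: nbhs_left_ge|exact: nbhs_left_lt].
apply: (cvg_unique _ mean_quotient_cvg) => //.
have Hc := Hgf_quotient_cvg; have Bcc := Bc_quotient_cvg.
have H0 := left_derive1_Hgf_ge0; have Bk := left_derive1_Bc_ge.
case: ifPn => [infty|].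
  apply/cvgeryP/cvgryPge => y.
  have b1 := sums_ge0 offdiag_ge0 sums_offdiag.
  (* The constant below bounds [beta * s - Bc c b s] on the unit interval. *)
  have K0 : 0 < beta - b 1%N + b 0%N.
    by have := beta_gt0; lra.
  (* [V] omits the finite sum of [mean_balance], which is nonnegative. *)
  pose V s := (1 - pi 0%N) * ((Bc c b s - Bc c b 1) / (s - 1))
    + s * pi 0%N * ((Hgf h s - Hgf h 1) / (s - 1)).
  have bound : \forall s \near (1 : R)^'-,
      V s / (beta - b 1%N + b 0%N) <= (1 - pgf pi s) / (1 - s).
    apply: filterS near01 => s s01; have /andP[s0 s1] := s01.
    have s01' : 0 <= s <= 1 by rewrite s0 ltW.
    rewrite ler_pdivrMr//.
    have X0 : 0 <= (1 - pgf pi s) / (1 - s).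
      rewrite divr_ge0 ?subr_ge0 ?(ltW s1)//.
      have [l wl] := sums_weighted pi_ge0 sums_pi s01'.
      by rewrite (sums_unique wl (sums_pgf s01')).
    apply: (@le_trans _ _ ((beta * s - Bc c b s) * ((1 - pgf pi s) / (1 - s)))).
      rewrite mean_balance// lerDl big_nat_cond sumr_ge0// => k /andP[/andP[_ kc] _].
      by rewrite !mulr_ge0 ?pi_ge0 ?exprn_ge0 ?subr_ge0 ?ler_nat ?(ltnW kc).
    rewrite mulrC ler_wpM2l//.
    have B0 := sums_ge0 _ (sums_offdiag_gf s01').
    have {B0} : 0 <= Bgf b s - b 1%N * s.
      by apply: B0 => k; rewrite mulr_ge0 ?offdiag_ge0 ?exprn_ge0.
    have cb : 0 <= c%:R * b 0%N * (1 - s) by rewrite !mulr_ge0// subr_ge0 ltW.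
    have bs : 0 <= - b 1%N * (1 - s) by rewrite mulr_ge0// subr_ge0 ltW.
    have bs0 : 0 <= b 0%N * s by rewrite mulr_ge0.
    have bes : beta * s <= beta by rewrite ler_piMr// ltW.
    by rewrite /Bc; nra.
  suff : \forall s \near (1 : R)^'-, y * (beta - b 1%N + b 0%N) <= V s.
    move=> yV; near=> s; apply: (@le_trans _ _ (V s / (beta - b 1%N + b 0%N))).
      by rewrite ler_pdivlMr//; near: s; exact: yV.
    by near: s; exact: bound.
  have [Dy|Dfin] := eqVneq (left_derive1 (Bc c b)) +oo%E.
    move: Bcc; rewrite Dy => /cvgeryP/cvgryPge.
    move=> /(_ (y * (beta - b 1%N + b 0%N) / (1 - pi 0%N))) Yy.
    apply: filterS2 near01 Yy => s s01 Yy; have /andP[s0 s1] := s01.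
    rewrite /V -[leLHS]addr0 lerD//.
      by rewrite [leRHS]mulrC -ler_pdivrMr ?subr_gt0.
    by apply: mulr_ge0; [rewrite mulr_ge0 ?pi_ge0|exact: Hgf_quotient_ge0].
  move: infty; rewrite (negbTE Dfin) orbF => /eqP muy.
  move: Hc; rewrite muy => /cvgeryP/cvgryPge.
  move=> /(_ ((y * (beta - b 1%N + b 0%N) - (1 - pi 0%N) * kappa) / (pi 0%N / 2))) Zy.
  have half : \forall s \near (1 : R)^'-, 2^-1 <= s.
    by apply: nbhs_left_ge; rewrite invf_lt1// ltr1n.
  apply: filterS3 near01 half Zy => s s01 sh; rewrite /V.
  have Z0 := Hgf_quotient_ge0 s01; have Yk := Bc_quotient_ge s01.
  move: (_ / (s - 1)) (_ / (s - 1)) Z0 Yk => Y Z Z0 Yk.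
  rewrite ler_pdivrMr ?divr_gt0// => Zy.
  have Y1 : (1 - pi 0%N) * kappa <= (1 - pi 0%N) * Y by rewrite ler_wpM2l // subr_ge0 ltW.
  have Z1 : 2^-1 * (pi 0%N * Z) <= s * (pi 0%N * Z) by rewrite ler_wpM2r// mulr_ge0// ltW.
  by lra.
rewrite negb_or => /andP[mu_fin D_fin].
have [m mE] : exists m, left_derive1 (Hgf h) = m%:E.
  by case: (left_derive1 _) H0 mu_fin => // m _ _; exists m.
have [D DE] : exists D, left_derive1 (Bc c b) = D%:E.
  by case: (left_derive1 _) Bk D_fin => // D _ _; exists D.
rewrite mE DE /=; rewrite mE in Hc; rewrite DE in Bcc.
move/fine_cvgP : Hc => [_ Hc]; move/fine_cvgP : Bcc => [_ Bcc].
apply: cvg_EFin; first exact: nearW.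
have cid : s @[s --> (1 : R)^'-] --> (1 : R) by apply: cvg_at_left_filter; exact: cvg_id.
have BcE : Bc c b s @[s --> (1 : R)^'-] --> 0.
  have : (s - 1) * ((Bc c b s - Bc c b 1) / (s - 1)) @[s --> (1 : R)^'-] --> (1 - 1) * D.
    by apply: cvgM => //; apply: cvgB => //; exact: cvg_cst.
  rewrite subrr mul0r; apply: cvg_trans; apply: near_eq_cvg.
  apply: filterS (nbhs_left_neq 1) => s s1.
  by rewrite mulrC divfK ?subr_eq0// Bc1 subr0.
have den : beta * s - Bc c b s @[s --> (1 : R)^'-] --> beta.
  rewrite -[X in _ --> X]subr0 -[X in _ --> X - _]mulr1.
  by apply: cvgB => //; apply: cvgM => //; exact: cvg_cst.
have num : (1 - pi 0%N) * ((Bc c b s - Bc c b 1) / (s - 1))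
  + s * pi 0%N * ((Hgf h s - Hgf h 1) / (s - 1))
  + \sum_(1 <= k < c) pi k * s ^+ k * (c%:R - k%:R) * b 0%N @[s --> (1 : R)^'-] -->
  (1 - pi 0%N) * D + 1 * pi 0%N * m + A1.
  apply: cvgD; first apply: cvgD.
  - by apply: cvgM => //; exact: cvg_cst.
  - by apply: cvgM => //; apply: cvgM => //; exact: cvg_cst.
  - apply: (cvg_partial_sum (a := fun k s => pi k * s ^+ k * (c%:R - k%:R) * b 0%N)
      (a' := fun k => pi k * (c%:R - k%:R) * b 0%N)) => k.
    have -> : pi k * (c%:R - k%:R) * b 0%N = pi k * 1 ^+ k * (c%:R - k%:R) * b 0%N.
      by rewrite expr1n mulr1.
    do 2 (apply: cvgM; last exact: cvg_cst).
    by apply: cvgM; [exact: cvg_cst|apply: cvg_at_left_filter; exact: exprn_continuous].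
have -> : ((1 - pi 0%N) * D + A1 + pi 0%N * m) / beta =
  ((1 - pi 0%N) * D + 1 * pi 0%N * m + A1) / beta by congr (_ / _); ring.
have XE := cvgM num (cvgV (lt0r_neq0 beta_gt0) den).
apply: cvg_trans (XE _ _); apply: near_eq_cvg.
have den0 : \forall s \near (1 : R)^'-, beta * s - Bc c b s != 0.
  exact: (@cvgr_neq0 _ _ _ _ _ (fun s => beta * s - Bc c b s) _ den (lt0r_neq0 beta_gt0)).
apply: filterS2 near01 den0 => s s01 d0.
by rewrite /= -mean_balance// mulrAC mulfV// mul1r.
Unshelve. all: by end_near. Qed.

(** From max(N - c, 0) + c = N + (c - min(N, c)); the last term is zero for
   [N >= c], so its mean is a finite sum, and finiteness of [c] allows it to be
   subtracted also when the mean of [N] is infinite. *)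
Lemma waiting_mean :
  (\sum_(0 <= k <oo) (Num.max (k%:R - c%:R) 0 * pi k)%:E =
   \sum_(0 <= k <oo) (k%:R * pi k)%:E
   + ((\sum_(0 <= k < c) pi k * (c%:R - k%:R)) - c%:R)%:E)%E.
Proof.
have max0 k : 0 <= Num.max (k%:R - c%:R) (0 : R) * pi k.
  by rewrite mulr_ge0 ?pi_ge0// le_max lexx orbT.
have min0 k : 0 <= pi k * (c%:R - (minn k c)%:R).
  by rewrite mulr_ge0 ?pi_ge0// subr_ge0 ler_nat geq_minr.
have k0 k : 0 <= k%:R * pi k by rewrite mulr_ge0 ?pi_ge0.
have c0 k : 0 <= c%:R * pi k by rewrite mulr_ge0 ?pi_ge0.
have Sc : (\sum_(0 <= k <oo) (c%:R * pi k)%:E = c%:R%:E)%E.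
  by apply/sums_nneseries => //; have := sumsZ c%:R sums_pi; rewrite mulr1.
have Smin : (\sum_(0 <= k <oo) (pi k * (c%:R - (minn k c)%:R))%:E =
    (\sum_(0 <= k < c) pi k * (c%:R - k%:R))%:E)%E.
  apply/sums_nneseries => //.
  rewrite (eq_big_nat _ _ (F2 := fun k => pi k * (c%:R - (minn k c)%:R))); last first.
    by move=> k /andP[_ kc]; rewrite (minn_idPl (ltnW kc)).
  by apply: sums_finite => k ck; rewrite (minn_idPr ck) subrr mulr0.
rewrite EFinB addeA -Smin -nneseriesD; [|by move=> k _ _; rewrite lee_fin..].
have -> : (\sum_(0 <= k <oo) ((k%:R * pi k)%:E + (pi k * (c%:R - (minn k c)%:R))%:E) =
    \sum_(0 <= k <oo) ((Num.max (k%:R - c%:R) 0 * pi k)%:E + (c%:R * pi k)%:E))%E.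
  apply: eq_eseriesr => k _; rewrite -!EFinD; congr EFin.
  case: (leqP k c) => kc.
    by rewrite (max_idPr _) ?subr_le0 ?ler_nat//; ring.
  by rewrite (max_idPl _) ?subr_ge0 ?ler_nat ?(ltnW kc)//; ring.
rewrite nneseriesD; [|by move=> k _ _; rewrite lee_fin..].
by rewrite Sc addeK.
Qed.

End QMatrices.

Theorem corollary4p1 (R : realType) (c : nat) (b h : nat -> R) (beta : R)
    (p pstar : nat -> nat -> R -> R) (pi : nat -> R) (u : R -> R)
    (d : measure_display) (T : measurableType d) (P : probability T R)
    (N : {RV P >-> nat})
    (c_ge1 : (1 <= c)%N)
    (b_ge0 : forall j : nat, j != 1%N -> 0 <= b j)
    (b1_lt0 : 0 < - b 1%N)
    (b_sum : (\sum_(0 <= j <oo | j != 1%N) (b j)%:E = (- b 1%N)%:E)%E)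
    (b0_gt0 : 0 < b 0%N)
    (b2_gt0 : (0 < \sum_(2 <= j <oo) (b j)%:E)%E)
    (beta_gt0 : 0 < beta)
    (h_ge0 : forall j, (1 <= j)%N -> 0 <= h j)
    (h_gt0 : (0 < \sum_(1 <= j <oo) (h j)%:E)%E)
    (h_fin : (\sum_(1 <= j <oo) (h j)%:E < +oo)%E)
    (p_tf : transition_function p)
    (p_q : has_q_matrix p (qmatrix c b h beta))
    (pi_eq : equilibrium_distribution p pi)
    (N_law : forall k, distribution P N [set k] = (pi k)%:E)
    (pstar_tf : transition_function pstar)
    (pstar_q : has_q_matrix pstar (qstar c b))
    (u_root : forall lambda : R, 0 < lambda ->
       0 < u lambda < 1 /\
       forall s : R, 0 <= s <= 1 -> (Ufun c b lambda s = 0 <-> s = u lambda)) :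
  let htot : R := limn (fun n => \sum_(1 <= j < n) h j) in
  let H := Hgf h in
  let L := Lsum h pstar in
  let mu1 := left_derive1 H in
  let dBc := left_derive1 (Bc c b) in
  let m := fine mu1 in
  let D := fine dBc in
  let ub := u beta in
  [/\ ('E_P[fun w => (N w)%:R%R])%E =
        (if (mu1 == +oo%E) || (dBc == +oo%E) then +oo%E else
         (pi 0%N * (((H ub - htot - m) * (- beta)
                     - (H ub - htot) * (D - beta)) / beta ^+ 2)
          + (\sum_(1 <= k < c)
               pi k * (c%:R - k%:R) * b 0%N
               * (beta + ub ^+ k.-1 * (1 - ub) * D)) / beta ^+ 2)%:E),
      ('E_P[fun w => (Num.max ((N w)%:R - c%:R) 0)%R])%E =
        (if (mu1 == +oo%E) || (dBc == +oo%E) then +oo%E else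
         (pi 0%N * (((H ub - htot - m) * (- beta)
                     - (H ub - htot) * (D - beta)) / beta ^+ 2 + c%:R)
          + (\sum_(1 <= k < c)
               pi k * (c%:R - k%:R)
               * (b 0%N * (beta + ub ^+ k.-1 * (1 - ub) * D) + beta ^+ 2))
              / beta ^+ 2
          - c%:R)%:E),
      pi 0%N = beta * (beta + H 1 - H ub
                 + \sum_(1 <= k < c) L k beta * ub ^+ k.-1 * (c%:R - k%:R)
                                     * b 0%N * (1 - ub))^-1 &
      forall k, (1 <= k <= c.-1)%N -> pi k = pi 0%N * L k beta].


Proof.
move=> htot' H L mu1 dBc m D ub.
have [/andP[ub0 ub1] ub_root] := u_root _ beta_gt0.
have Uu : Ufun c b beta ub = 0 by apply/ub_root; rewrite ?(ltW ub0) ?(ltW ub1).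
have u01 : 0 < ub <= 1 by rewrite ub0 ltW.
have id := pi0_identity b_ge0 b_sum beta_gt0 h_ge0 h_fin p_tf p_q pi_eq u01 Uu.
have res k := pi_resolvent b_ge0 b_sum beta_gt0 h_ge0 h_fin p_tf p_q pi_eq
  pstar_tf pstar_q (j := k).
have mean := mean_formula b_ge0 b_sum beta_gt0 h_ge0 h_fin p_tf p_q pi_eq
  pstar_tf pstar_q h_gt0 u01 Uu.
set A1 := \sum_(1 <= k < c) _ in mean.
set A2 := \sum_(1 <= k < c) _ in id.
rewrite -/H -/mu1 -/dBc -/D -/m in mean.
have {}id : pi 0%N * (beta + htot' - H ub) + A2 = beta by exact: id.
(* With [EN], this is where the identity for [pi 0] eliminates the terms in [ub]
   from the two stated formulas. *)
have A12 : \sum_(1 <= k < c) pi k * (c%:R - k%:R) * b 0%N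
    * (beta + ub ^+ k.-1 * (1 - ub) * D) = beta * A1 + D * A2.
  rewrite /A1 /A2 !mulr_sumr -big_split /=.
  by apply: eq_bigr => k _; ring.
have EN : ((1 - pi 0%N) * D + A1 + pi 0%N * m) / beta =
    pi 0%N * (((H ub - htot' - m) * (- beta)
                     - (H ub - htot') * (D - beta)) / beta ^+ 2)
          + (beta * A1 + D * A2) / beta ^+ 2.
  have -> : A2 = beta - pi 0%N * (beta + htot' - H ub) by lra.
  by field; exact: lt0r_neq0.
split.
- rewrite (expectation_nat (g := fun k => k%:R) N_law)// mean A12.
  by case: ifP => // _; rewrite EN.
- rewrite (expectation_nat (g := fun k => Num.max (k%:R - c%:R) 0) N_law); last first.
    by move=> k; rewrite le_max lexx orbT.
  rewrite (waiting_mean pi_eq) mean.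
  case: ifP => [//|_]; rewrite -EFinD; congr EFin; rewrite EN.
  rewrite -[\sum_(1 <= k < c) pi k * (c%:R - k%:R) * (_ + _)](_ : beta * A1 + D * A2
    + beta ^+ 2 * \sum_(1 <= k < c) pi k * (c%:R - k%:R) = _); last first.
    rewrite -A12 mulr_sumr -big_split /=.
    by apply: eq_bigr => k _; ring.
  rewrite big_ltn// subr0.
  by field; exact: lt0r_neq0.
- have H1 : H 1 = htot' by exact: (Hgf1 h_ge0 h_fin).
  set X := (X in beta * X^-1).
  have X_id : pi 0%N * X = beta.
    rewrite -[RHS]id /X H1 mulrDr; congr (_ + _).
    rewrite /A2 mulr_sumr; apply: eq_big_nat => k /andP[k1 _].
    by rewrite (res k)// /L; ring.
  have X0 : X != 0.
    by apply: contra_neq (lt0r_neq0 beta_gt0) => X0; rewrite -X_id X0 mulr0.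
  by rewrite -X_id mulfK.
- by move=> k /andP[k1 _]; exact: res.
Qed.
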